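(* Let $n,m\ge 0$ be integers. Let $A$ and $B$ be infinite virtually abelian finitely generated groups, with growth degrees $a$ and $b$ respectively. Then the following are equivalent: (i) $\mathsf{Shuffler}^{\circ n}(A)$ and $\mathsf{Shuffler}^{\circ m}(B)$ are quasi-isometric. (ii) $n=m$ and $a=b$. (iii) $\mathsf{Shuffler}^{\circ n}(A)$ and $\mathsf{Shuffler}^{\circ m}(B)$ are biLipschitz equivalent.
   Context: Lampshuffler: $\mathsf{Shuffler}(H)=\mathsf{FSym}(H)\rtimes H$, where $\mathsf{FSym}(H)$ is the group of finitely supported bijections $H\to H$ and $H$ acts by $(h\cdot\sigma)(x)=h\sigma(h^{-1}x)$. Iterates: $\mathsf{Shuffler}^{\circ 0}(H)=H$ and $\mathsf{Shuffler}^{\circ n}(H)=\mathsf{Shuffler}(\mathsf{Shuffler}^{\circ(n-1)}(H))$ for $n\ge 1$. Finitely generated groups are endowed with word metrics associated to finite generating sets. A biLipschitz equivalence is a bijective quasi-isometry between such groups. The growth degree is the degree of polynomial volume growth. *)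

(* Defs.v *)
From HB Require Import structures.
From mathcomp Require Import all_boot all_order all_algebra finmap.
From mathcomp Require Import all_classical all_reals.

Set Implicit Arguments.
Unset Strict Implicit.
Unset Printing Implicit Defensive.

Import Order.TTheory GRing.Theory Num.Theory.

Local Open Scope classical_set_scope.
Local Open Scope group_scope.

Record FSym (T : Type) := MkFSym {
  fsym_fun :> T -> T;
  fsym_bij : bijective fsym_fun;
  fsym_fin : finite_set [set x | fsym_fun x <> x]
}.

Section FSymGroup.
Variable T : Type.
Implicit Types s t u : FSym T.

HB.instance Definition _ := gen_eqMixin (FSym T).
HB.instance Definition _ := gen_choiceMixin (FSym T).

Lemma fsymP s t : s =1 t -> s = t.
Proof.
case: s t => [f bf ff] [g bg fg] /= /funext fg_eq.
by subst g; rewrite (Prop_irrelevance bf bg) (Prop_irrelevance ff fg).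
Qed.

Lemma fsym_one_fin : finite_set [set x : T | id x <> x].
Proof. by apply: (sub_finite_set _ (@finite_set0 T)) => x; apply. Qed.

Definition fsym_one : FSym T := MkFSym (Bijective (frefl id) (frefl id)) fsym_one_fin.

Lemma fsym_mul_fin s t : finite_set [set x | (s \o t) x <> x].
Proof.
have fu : finite_set ([set x | s x <> x] `|` [set x | t x <> x]).
  by rewrite finite_setU; split; apply: fsym_fin.
apply: (sub_finite_set _ fu) => x /= nx.
have [tx|tx] := pselect (t x = x); last by right.
by left => sx; apply: nx; rewrite tx sx.
Qed.

Definition fsym_mul s t : FSym T :=
  MkFSym (bij_comp (fsym_bij s) (fsym_bij t)) (fsym_mul_fin s t).

Lemma fsym_invfun_ex s : exists g : T -> T, cancel s g /\ cancel g s.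
Proof. by case: (fsym_bij s) => g sg gs; exists g. Qed.

Definition fsym_invfun s : T -> T := sval (cid (fsym_invfun_ex s)).

Lemma fsym_invfunK s : cancel s (fsym_invfun s).
Proof. by rewrite /fsym_invfun; case: cid => g []. Qed.

Lemma fsym_invfunVK s : cancel (fsym_invfun s) s.
Proof. by rewrite /fsym_invfun; case: cid => g []. Qed.

Lemma fsym_inv_fin s : finite_set [set x | fsym_invfun s x <> x].
Proof.
apply: (sub_finite_set _ (fsym_fin s)) => x /= nx sx; apply: nx.
by rewrite -{1}sx fsym_invfunK.
Qed.

Definition fsym_inv s : FSym T :=
  MkFSym (Bijective (fsym_invfunVK s) (fsym_invfunK s)) (fsym_inv_fin s).

Lemma fsym_mulA : associative fsym_mul.
Proof. by move=> s t u; apply: fsymP. Qed.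

Lemma fsym_mul1 : left_id fsym_one fsym_mul.
Proof. by move=> s; apply: fsymP. Qed.

Lemma fsym_mulr1 : right_id fsym_one fsym_mul.
Proof. by move=> s; apply: fsymP. Qed.

Lemma fsym_mulV : left_inverse fsym_one fsym_inv fsym_mul.
Proof. by move=> s; apply: fsymP => x; apply: fsym_invfunK. Qed.

Lemma fsym_mulrV : right_inverse fsym_one fsym_inv fsym_mul.
Proof. by move=> s; apply: fsymP => x; apply: fsym_invfunVK. Qed.

HB.instance Definition _ := isGroup.Build (FSym T)
  fsym_mulA fsym_mul1 fsym_mulr1 fsym_mulV fsym_mulrV.

End FSymGroup.

Section FSymAction.
Variable H : groupType.
Implicit Types (h k : H) (s t : FSym H).

Lemma fsym_act_bij h s : bijective (fun x => h * s (h^-1 * x)).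
Proof.
exists (fun x => h * fsym_invfun s (h^-1 * x)) => x; rewrite mulKg.
  by rewrite fsym_invfunK mulVKg.
by rewrite fsym_invfunVK mulVKg.
Qed.

Lemma fsym_act_fin h s : finite_set [set x | h * s (h^-1 * x) <> x].
Proof.
have fi : finite_set ((fun x => h * x) @` [set x | s x <> x]).
  by apply: finite_image; apply: fsym_fin.
apply: (sub_finite_set _ fi) => x /= nx; exists (h^-1 * x); last exact: mulVKg.
by move=> sx; apply: nx; rewrite sx mulVKg.
Qed.

Definition fsym_act h s : FSym H := MkFSym (fsym_act_bij h s) (fsym_act_fin h s).

Lemma fsym_act1 s : fsym_act 1 s = s.
Proof. by apply: fsymP => x /=; rewrite invg1 !mul1g. Qed.

Lemma fsym_actA h k s : fsym_act h (fsym_act k s) = fsym_act (h * k) s.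
Proof. by apply: fsymP => x /=; rewrite invgM !mulgA. Qed.

Lemma fsym_actM h s t : fsym_act h (s * t) = fsym_act h s * fsym_act h t.
Proof. by apply: fsymP => x /=; rewrite mulKg. Qed.

Lemma fsym_act_one h : fsym_act h 1 = 1.
Proof. by apply: fsymP => x /=; rewrite mulVKg. Qed.

End FSymAction.

(* A dedicated record rather than [FSym H * H], since products of groups
   already carry the direct product structure. *)
Record shuffler (H : Type) := Shuffle { shuf_perm : FSym H; shuf_pos : H }.

Section ShufflerGroup.
Variable H : groupType.
Implicit Types a b c : shuffler H.

HB.instance Definition _ := gen_eqMixin (shuffler H).
HB.instance Definition _ := gen_choiceMixin (shuffler H).

Definition shuffler_one : shuffler H := Shuffle 1 1.

Definition shuffler_mul a b : shuffler H :=
  Shuffle (shuf_perm a * fsym_act (shuf_pos a) (shuf_perm b)) (shuf_pos a * shuf_pos b).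

Definition shuffler_inv a : shuffler H :=
  Shuffle (fsym_act (shuf_pos a)^-1 (shuf_perm a)^-1) (shuf_pos a)^-1.

Lemma shuffler_mulA : associative shuffler_mul.
Proof.
move=> [s h] [t k] [u l]; rewrite /shuffler_mul /=.
by rewrite fsym_actM fsym_actA !mulgA.
Qed.

Lemma shuffler_mul1 : left_id shuffler_one shuffler_mul.
Proof. by move=> [s h]; rewrite /shuffler_mul /= fsym_act1 !mul1g. Qed.

Lemma shuffler_mulr1 : right_id shuffler_one shuffler_mul.
Proof. by move=> [s h]; rewrite /shuffler_mul /= fsym_act_one !mulg1. Qed.

Lemma shuffler_mulV : left_inverse shuffler_one shuffler_inv shuffler_mul.
Proof.
move=> [s h]; rewrite /shuffler_mul /shuffler_one /=.
by rewrite -fsym_actM !mulVg fsym_act_one.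
Qed.

Lemma shuffler_mulrV : right_inverse shuffler_one shuffler_inv shuffler_mul.
Proof.
move=> [s h]; rewrite /shuffler_mul /shuffler_one /=.
by rewrite fsym_actA !mulgV fsym_act1 mulgV.
Qed.

HB.instance Definition _ := isGroup.Build (shuffler H)
  shuffler_mulA shuffler_mul1 shuffler_mulr1 shuffler_mulV shuffler_mulrV.

End ShufflerGroup.

Definition Shuffler (H : groupType) : groupType := shuffler H.

Definition iter_Shuffler (n : nat) (H : groupType) : groupType :=
  iter n Shuffler H.

Section WordMetric.
Variable G : groupType.
Implicit Types (S : set G) (g h : G) (n : nat).

Definition word_ball S n : set G :=
  [set g | exists w : seq G,
     [/\ (size w <= n)%N,
         (forall x, x \in w -> S x \/ S x^-1)
       & g = \prod_(x <- w) x]].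

Definition finite_generating_set S : Prop :=
  finite_set S /\ forall g, exists n, word_ball S n g.

Definition finitely_generated : Prop := exists S, finite_generating_set S.

(* The value 0 for elements outside the subgroup generated by [S] is junk. *)
Definition word_length S g : nat :=
  if pselect (exists n, `[< word_ball S n g >]) is left h then ex_minn h else 0%N.

Definition word_metric (R : realType) S g h : R :=
  ((word_length S (g^-1 * h))%:R)%R.

Definition growth_function S n : nat := #|` fset_set (word_ball S n) |.

(* A relation rather than a function: not every group has polynomial growth.
   The choice of [S] is immaterial. *)
Definition has_growth_degree (R : realType) (d : nat) : Prop :=
  exists2 S, finite_generating_set S &
  exists2 C : R, (0 < C)%R &
  forall n, (0 < n)%N ->
    (C^-1 * n%:R ^+ d <= (growth_function S n)%:R <= C * n%:R ^+ d)%R.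

Definition virtually_abelian : Prop :=
  exists K : {pred G},
    [/\ group_closed K,
        {in K &, forall x y, commute x y}
      & finite_set [set [set g * k | k in [set` K]] | g in [set: G]]].

End WordMetric.

Definition quasi_isometry (R : realType) (X Y : Type)
    (dX : X -> X -> R) (dY : Y -> Y -> R) (f : X -> Y) : Prop :=
  exists C K : R,
    [/\ (1 <= C)%R, (0 <= K)%R,
        (forall x x', C^-1 * dX x x' - K <= dY (f x) (f x') <= C * dX x x' + K)%R
      & (forall y, exists x, dY (f x) y <= K)%R].

(* For finitely generated groups, the two relations below do not depend on the
   choice of the finite generating sets. *)
Definition quasi_isometric (R : realType) (G H : groupType) : Prop :=
  exists (S : set G) (T : set H),
    [/\ finite_generating_set S, finite_generating_set T
      & exists f : G -> H,
          quasi_isometry (word_metric R S) (word_metric R T) f].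

Definition biLipschitz_equivalent (R : realType) (G H : groupType) : Prop :=
  exists (S : set G) (T : set H),
    [/\ finite_generating_set S, finite_generating_set T
      & exists2 f : G -> H, bijective f
          & quasi_isometry (word_metric R S) (word_metric R T) f].

(* Main.v *)
Require Import Defs.
From mathcomp Require Import all_boot all_order all_algebra finmap zify.
From mathcomp Require Import all_classical all_reals.

(* A quasi-isometry forces [n = m] and [a = b].  Let [F_G N] be the least size
   of a nonempty finite [T] in [G] with [N * #|boundary T| <= #|T|]; up to
   constants, it is a quasi-isometry invariant.  Growth of degree [a] gives
   [F_A N ~ N ^ a] (balls from above, Coulhon--Saloff-Coste from below).  If
   [T0] is almost invariant in [H], so is the set of pairs (permutation
   supported in [T0], point of [T0]) in [Shuffler H], hence
   [F_(Shuffler H) <= F_H ^ (2 F_H)].  Conversely, most fibers over [FSym H] of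
   an almost invariant set of [Shuffler H] are almost invariant in [H], so they
   have size at least [F_H]; since the arrow can also swap two adjacent values,
   the permutations involved span about [F_H] edges per vertex, and edge
   isoperimetry makes their number exponential in [F_H].  Iterating, [F] is an
   [n]-fold exponential of [N ^ a] up to logarithmic factors, which determines
   [n] and [a].

   For the biLipschitz equivalence, call a map bornologous when it sends right
   translation by a finite set into right translation by a finite set.  Between
   finitely generated groups, a bijection bornologous in both directions is
   biLipschitz, and [Shuffler] acts functorially on such bijections by
   conjugation.  An infinite finitely generated virtually abelian group is a
   finite disjoint union of cosets of some [Z^d] with [d > 0], and
   [Z^d * {0..k-1}] is identified with [Z^d] by Euclidean division in the first
   coordinate; counting points of balls gives [d = a]. *)

Set Implicit Arguments.
Unset Strict Implicit.
Unset Printing Implicit Defensive.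

Import Order.TTheory GRing.Theory Num.Theory.

(** * Iterated exponentials *)

Fixpoint tower (k x : nat) : nat :=
  if k is k'.+1 then 2 ^ tower k' x else x.

Lemma ltn_tower k x y : (tower k x < tower k y) = (x < y).
Proof. by elim: k => //= k IH; rewrite ltn_exp2l. Qed.

Lemma leq_tower k x y : (tower k x <= tower k y) = (x <= y).
Proof. by rewrite leqNgt ltn_tower -leqNgt. Qed.

Lemma tower_ge k x : x <= tower k x.
Proof. by elim: k => //= k IH; apply: (leq_trans IH); apply/ltnW/ltn_expl. Qed.

Lemma towerD j k x : tower (j + k) x = tower j (tower k x).
Proof. by elim: j => //= j ->. Qed.

(** Constants can be moved into the argument of a tower: [c.+1 * 2 ^ t <= 2 ^ (c + t) <= 2 ^ (c.+1 *
    t)] for [t > 0]. *)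
Lemma muln_tower c k x : 0 < x -> c * tower k x <= tower k (c * x).
Proof.
move=> x0; case: c => [|c]; first by rewrite mul0n.
elim: k => //= k IH.
apply: (@leq_trans (2 ^ (c.+1 * tower k x))); last by rewrite leq_exp2l.
have t0 : 0 < tower k x by apply: leq_trans (tower_ge k x).
rewrite [in leqRHS]mulSn expnD [leqRHS]mulnC leq_mul2r; apply/orP; right.
apply: (@leq_trans (2 ^ c)); first exact: ltn_expl.
by rewrite leq_exp2l // leq_pmulr.
Qed.

Lemma linear_le_exp2 p q : exists n, p * n + q <= 2 ^ n.
Proof.
(* At [n = 2 * k] the left side is at most [k.+1 ^ 2], hence at most [(2 ^ k) ^ 2]. *)
exists ((2 * p + q).*2); set k := 2 * p + q; rewrite -addnn expnD.
have h : k < 2 ^ k by apply: ltn_expl.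
by apply: (@leq_trans (k.+1 * k.+1)); [nia | apply: leq_mul].
Qed.

Lemma leq_expl m n e : m <= n -> m ^ e <= n ^ e.
Proof. by case: e => // e mn; rewrite leq_exp2r. Qed.

(** The inequality [4 * a * b <= (a + b) ^ 2] is raised to the power [a]; the other [b - a] factors
    use [b <= a + b]. In base 2 logarithms, [x log x] is superadditive with a gain of [2 * a]. *)
Lemma expn_mid a b : a <= b -> a ^ a * b ^ b * 4 ^ a <= (a + b) ^ (a + b).
Proof.
move=> ab; have h : a ^ a * b ^ a * 4 ^ a <= (a + b) ^ a * (a + b) ^ a.
  by rewrite -!expnMn; apply: leq_expl; nia.
have h2 : b ^ (b - a) <= (a + b) ^ (b - a) by apply: leq_expl; lia.
have -> : b ^ b = b ^ a * b ^ (b - a) by rewrite -expnD subnKC.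
have -> : (a + b) ^ (a + b) = (a + b) ^ a * (a + b) ^ a * (a + b) ^ (b - a).
  by rewrite -!expnD; congr (_ ^ _); lia.
apply: leq_trans (leq_mul h h2); rewrite leq_eqVlt; apply/orP; left; apply/eqP.
by rewrite -!mulnA [4 ^ a * _]mulnC.
Qed.

(** * Edge isoperimetry in the finitary symmetric group *)

Local Open Scope fset_scope.
Local Open Scope group_scope.

Lemma leq_card_seq (T : choiceType) (A : {fset T}) (s : seq T) :
  {subset A <= s} -> (#|` A| <= size s)%N.
Proof. by move=> As; apply: uniq_leq_size => //; apply: fset_uniq. Qed.

Lemma leq_card_inj (T U : choiceType) (f : T -> U) (A : {fset T}) (B : {fset U}) :
  {in A &, injective f} -> (forall x, x \in A -> f x \in B) -> (#|` A| <= #|` B|)%N.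
Proof.
move=> f_inj fAB; have <- : #|` f @` A| = #|` A| by apply: card_in_imfset.
by apply: fsubset_leq_card; apply/fsubsetP => y /imfsetP[x /= xA ->]; apply: fAB.
Qed.

Section Transposition.
Variable T : choiceType.
Implicit Types x y z : T.

Definition swap_fun x y z := if z == x then y else if z == y then x else z.

Lemma swap_funK x y : involutive (swap_fun x y).
Proof.
move=> z; rewrite /swap_fun.
have [->|zx] := eqVneq z x; first by rewrite eqxx; case: eqVneq.
have [->|zy] := eqVneq z y; first by rewrite eqxx.
by rewrite (negbTE zx) (negbTE zy).
Qed.

Lemma swap_fun_fin x y : finite_set [set z | swap_fun x y z <> z]%classic.
Proof.
apply: (sub_finite_set _ (finite_set2 x y)) => z /=; rewrite /swap_fun.
by case: eqVneq => [->|zx]; [left | case: eqVneq => [->|//]; right].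
Qed.

Definition fswap x y : FSym T :=
  MkFSym (inv_bij (swap_funK x y)) (swap_fun_fin x y).

Lemma fswapL x y : fswap x y x = y. Proof. by rewrite /= /swap_fun eqxx. Qed.

Lemma fswapR x y : fswap x y y = x.
Proof. by rewrite /= /swap_fun eqxx; case: eqVneq. Qed.

Lemma fswapD x y z : z <> x -> z <> y -> fswap x y z = z.
Proof. by move=> /eqP/negbTE zx /eqP/negbTE zy; rewrite /= /swap_fun zx zy. Qed.

Lemma fswapK x y : fswap x y * fswap x y = 1.
Proof. by apply: fsymP => z /=; apply: swap_funK. Qed.

Lemma fswapxx x : fswap x x = 1.
Proof. by apply: fsymP => z /=; rewrite /swap_fun; case: eqVneq. Qed.

Lemma fswapC x y : fswap x y = fswap y x.
Proof.
apply: fsymP => z /=; rewrite /swap_fun.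
by case: (eqVneq z x) => [->|]; case: (eqVneq _ y).
Qed.

Lemma fswap_trans x y z : x <> z -> y <> z ->
  fswap x y * fswap y z * fswap x y = fswap x z.
Proof.
move=> /eqP xz /eqP yz; apply: fsymP => t /=; rewrite /swap_fun.
have [zx zy] : (z == x) = false /\ (z == y) = false by rewrite !(eq_sym z); split; apply/negbTE.
case: (eqVneq t x) => [_|tx].
  by rewrite eqxx zx zy.
case: (eqVneq t y) => [ty|ty].
  rewrite ty in tx *.
  by have [xy|xy] := eqVneq x y; [rewrite xy eqxx in tx | rewrite ?(negbTE xz) ?(negbTE yz) ?eqxx].
have [->|tz] := eqVneq t z; last by rewrite (negbTE ty) /= (negbTE tx) (negbTE ty).
by rewrite zy /=; have [->|yx] := eqVneq y x; rewrite ?eqxx.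
Qed.

End Transposition.

Section ShufflerBasics.
Variable H : groupType.
Implicit Types (s p x : H) (t : Shuffler H).

Definition mover s : Shuffler H := Shuffle 1 s.
Definition switch x y : Shuffler H := Shuffle (fswap x y) 1.

Lemma mul_shuffleE (f g : FSym H) (p q : H) :
  (Shuffle f p : Shuffler H) * Shuffle g q = Shuffle (f * fsym_act p g) (p * q).
Proof. by []. Qed.

Lemma mul_mover t s : t * mover s = Shuffle (shuf_perm t) (shuf_pos t * s).
Proof. by case: t => f p; rewrite mul_shuffleE fsym_act_one mulg1. Qed.

Lemma fsym_act_swap p x y : fsym_act p (fswap x y) = fswap (p * x) (p * y).
Proof.
apply: fsymP => z /=; rewrite /swap_fun.
rewrite -(inj_eq (mulgI p) _ x) -(inj_eq (mulgI p) _ y) mulVKg.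
by case: eqP => // _; case: eqP => // _; rewrite mulVKg.
Qed.

Lemma mul_switch t s : t * switch 1 s =
  Shuffle (shuf_perm t * fswap (shuf_pos t) (shuf_pos t * s)) (shuf_pos t).
Proof.
by case: t => f p; rewrite mul_shuffleE fsym_act_swap !mulg1.
Qed.

(* Splitting [F] according to the value at one point [x] only cuts the edges
   [f -- f * (p ps)] with [x \in {p, ps}], hence at most [2 min] of them each
   way, a loss absorbed by [expn_mid]. *)
Lemma edge_isoperimetry s (F : {fset FSym H}) (P : {fset Shuffler H}) : s != 1 ->
  (forall t, t \in P -> shuf_perm t \in F /\ shuf_perm (t * switch 1 s) \in F) ->
  (2 ^ #|` P| <= (#|` F| ^ #|` F|) ^ 2)%N.
Proof.
move=> s1; have [n] := ubnP #|` F|; elim: n F P => // n IH F P Fn PF.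
have [->|/fset0Pn[t0 t0P]] := eqVneq P fset0.
  rewrite cardfs0 expn0 expn_gt0 expn_gt0.
  by case: #|` F|.
(* The switch changes the value at the arrow of [t0], so cutting at this point leaves both halves
   nonempty, as the induction on the size of [F] requires. *)
pose x := shuf_pos t0; pose v := shuf_perm t0 x.
pose F1 := [fset f in F | (f : FSym H) x == v].
pose F2 := [fset f in F | (f : FSym H) x != v].
have cardF : #|` F| = (#|` F1| + #|` F2|)%N.
  rewrite -(cardfsID F1 F).
  have -> : F `&` F1 = F1 by apply/fsetP => f; rewrite !inE; case: (f \in F).
  have -> // : F `\` F1 = F2.
  by apply/fsetP => f; rewrite !inE; case: (f \in F); rewrite ?andbT ?andbF.
have F1gt0 : (0 < #|` F1|)%N.
  rewrite cardfs_gt0; apply/fset0Pn; exists (shuf_perm t0).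
  by rewrite !inE eqxx andbT; case: (PF _ t0P).
have xv : shuf_perm (t0 * switch 1 s) x <> v.
  rewrite mul_switch; change (shuf_perm t0 (fswap x (x * s) x) <> v).
  rewrite fswapL => e; have xs : x * s = x := bij_inj (fsym_bij _) e.
  move/eqP: s1; apply.
  by rewrite -(mulKg x s) xs mulVg.
have F1P f : reflect (f \in F /\ f x = v) (f \in F1).
  by rewrite !inE; apply: (iffP andP) => -[fF /eqP].
have F2P f : reflect (f \in F /\ f x <> v) (f \in F2).
  by rewrite !inE; apply: (iffP andP) => -[fF /eqP].
have F2gt0 : (0 < #|` F2|)%N.
  rewrite cardfs_gt0; apply/fset0Pn; exists (shuf_perm (t0 * switch 1 s)).
  by apply/F2P; case: (PF _ t0P).
pose P1 := [fset t in P | (shuf_perm t \in F1) && (shuf_perm (t * switch 1 s) \in F1)].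
pose P2 := [fset t in P | (shuf_perm t \in F2) && (shuf_perm (t * switch 1 s) \in F2)].
pose P3 := [fset t in P | (shuf_perm t \in F1) && (shuf_perm (t * switch 1 s) \in F2)].
pose P4 := [fset t in P | (shuf_perm t \in F2) && (shuf_perm (t * switch 1 s) \in F1)].
have cut (t : Shuffler H) : shuf_perm t x <> shuf_perm (t * switch 1 s) x ->
    shuf_pos t \in [:: x; x * s^-1].
  move=> ne; apply/negPn/negP; rewrite !in_cons negb_or => /andP[/eqP px].
  rewrite in_nil orbF => /eqP psx; apply: ne; rewrite mul_switch.
  change (shuf_perm t x = shuf_perm t (fswap (shuf_pos t) (shuf_pos t * s) x)).
  by rewrite fswapD // => e; [apply: px | apply: psx; rewrite e mulgK].
(* A cut edge is determined by one endpoint and one of two positions. [cutL] counts by the endpoint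
   before the switch, [cutR] by the one after it, so that [P3] and [P4] can both be charged to the
   smaller half. *)
have cutL (F' : {fset FSym H}) (P' : {fset Shuffler H}) :
    (forall t, t \in P' -> shuf_perm t \in F' /\ shuf_pos t \in [:: x; x * s^-1]) ->
    (#|` P'| <= 2 * #|` F'|)%N.
  move=> h; pose mk f p : Shuffler H := Shuffle f p.
  apply: (@leq_trans (size [seq mk f p | f <- enum_fset F', p <- [:: x; x * s^-1]])).
    by apply: leq_card_seq => -[f p] /h[fF pp]; apply: (allpairs_f mk).
  by rewrite size_allpairs /= mulnC.
have cutR (F' : {fset FSym H}) (P' : {fset Shuffler H}) :
    (forall t, t \in P' -> shuf_perm (t * switch 1 s) \in F' /\ shuf_pos t \in [:: x; x * s^-1]) ->
    (#|` P'| <= 2 * #|` F'|)%N.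
  move=> h.
  have <- : #|` [fset t * switch 1 s | t in P']| = #|` P'|.
    by apply: card_imfset; apply: mulIg.
  apply: cutL => _ /imfsetP[t /= tP ->]; case: (h t tP) => tF tp.
  by rewrite {2}mul_switch.
have P3P t : t \in P3 -> [/\ shuf_perm t \in F1, shuf_perm (t * switch 1 s) \in F2
    & shuf_pos t \in [:: x; x * s^-1]].
  rewrite in_fset /= => /andP[_ /andP[t1 t2]]; split=> //; apply: cut.
  by move/F1P: t1 => [_ ->]; move/F2P: t2 => [_ /nesym].
have P4P t : t \in P4 -> [/\ shuf_perm t \in F2, shuf_perm (t * switch 1 s) \in F1
    & shuf_pos t \in [:: x; x * s^-1]].
  rewrite in_fset /= => /andP[_ /andP[t2 t1]]; split=> //; apply: cut.
  by move/F1P: t1 => [_ ->]; move/F2P: t2 => [_ ].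
have cardP : (#|` P| <= #|` P1| + #|` P2| + (#|` P3| + #|` P4|))%N.
  have PU : P `<=` P1 `|` P2 `|` (P3 `|` P4).
    apply/fsubsetP => t tP; rewrite !in_fsetU !in_fset /= !inE /= tP /=.
    have [-> ->] /= := PF t tP.
    by do 2 (case: (_ == v)).
  apply: leq_trans (fsubset_leq_card PU) _.
  apply: leq_trans (leq_card_fsetU _ _) _.
  by apply: leq_add; apply: leq_card_fsetU.
have h1 : (2 ^ #|` P1| <= (#|` F1| ^ #|` F1|) ^ 2)%N.
  apply: IH => [|t]; first by lia.
  by rewrite in_fset /= => /andP[_ /andP[]].
have h2 : (2 ^ #|` P2| <= (#|` F2| ^ #|` F2|) ^ 2)%N.
  apply: IH => [|t]; first by lia.
  by rewrite in_fset /= => /andP[_ /andP[]].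
have h3 : (#|` P3| <= 2 * minn #|` F1| #|` F2|)%N.
  by rewrite /minn; case: ifP => _; [apply: cutL | apply: cutR] => t /P3P[].
have h4 : (#|` P4| <= 2 * minn #|` F1| #|` F2|)%N.
  by rewrite /minn; case: ifP => _; [apply: cutR | apply: cutL] => t /P4P[].
set m := minn _ _ in h3 h4; rewrite cardF.
have mid : (#|` F1| ^ #|` F1| * #|` F2| ^ #|` F2| * 4 ^ m <=
            (#|` F1| + #|` F2|) ^ (#|` F1| + #|` F2|))%N.
  rewrite /m; have [le|le] := leqP #|` F1| #|` F2|; first exact: expn_mid.
  by rewrite addnC [(_ * #|` F2| ^ _)%N]mulnC; apply: expn_mid; apply: ltnW.
apply: leq_trans (leq_expl 2 mid); rewrite !expnMn.
(* The cut edges number at most [4 * m], which is exactly what the gain [(4 ^ m) ^ 2] pays for. *)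
have -> : ((4 ^ m) ^ 2 = 2 ^ (2 * m + 2 * m))%N.
  by rewrite -expnM -[4%N]/(2 ^ 2)%N -expnM; congr (_ ^ _)%N; lia.
apply: leq_trans (leq_mul (leq_mul h1 h2) (leqnn _)).
by rewrite -!expnD leq_exp2l //; lia.
Qed.

End ShufflerBasics.

(** * Folner sets of lampshufflers *)

Lemma card_fset_sep (I : choiceType) (P : pred I) (A : {fset I}) :
  #|` [fset t in A | P t]| = (\sum_(t <- A) P t)%N.
Proof.
rewrite card_fset_sum1 big_fset /= big_mkcond /=.
by apply: eq_bigr => t _; case: (P t).
Qed.

Lemma card_fibers (I J : choiceType) (h : I -> J) (A : {fset I}) (B : {fset J}) :
  (forall t, t \in A -> h t \in B) ->
  #|` A| = (\sum_(f <- B) #|` [fset t in A | h t == f]|)%N.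
Proof.
move=> hAB; rewrite card_fset_sum1.
under [RHS]eq_bigr do rewrite card_fset_sep.
rewrite exchange_big /= big_seq [RHS]big_seq; apply: eq_bigr => t /hAB ht.
have -> : (\sum_(f <- B) (h t == f) = count (pred1 (h t)) B)%N.
  rewrite -sum1_count [RHS]big_mkcond; apply: eq_bigr => f _ /=.
  by rewrite eq_sym; case: eqP.
by rewrite count_uniq_mem ?fset_uniq ?ht.
Qed.

Section Folner.
Variable G : groupType.
Implicit Types (S : seq G) (T : {fset G}).

Definition boundary S T : {fset G} :=
  [fset t in T | has (fun s => t * s \notin T) S].

Definition folner S (N : nat) T : Prop :=
  T != fset0 /\ (N * #|` boundary S T| <= #|` T|)%N.

Lemma boundaryP S T t :
  reflect (t \in T /\ exists2 s, s \in S & t * s \notin T) (t \in boundary S T).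
Proof. by rewrite in_fset; apply: (iffP andP) => -[tT /hasP]. Qed.

(* The least size of an [N]-Folner set is at least a [k]-fold exponential of
   [N ^ a / C], respectively at most one of [C * N ^ a * log N], the latter only
   for [N = 2 ^ l]. *)
Definition folner_lower (a k : nat) : Prop :=
  exists S C, (0 < C)%N /\ forall N T x, (0 < x)%N -> (C * x <= N ^ a)%N ->
    folner S N T -> (tower k x <= #|` T|)%N.

Definition folner_upper (a k : nat) : Prop :=
  forall S, exists2 C, (0 < C)%N & forall l, exists T, folner S (2 ^ l) T /\
    (#|` T| <= tower k (C * (2 ^ (a * l) * l.+1)))%N.

End Folner.

(** * Lower bound: Folner sets of a lampshuffler are exponentially larger *)

Section ShufflerLower.
Variable H : groupType.
Variables (S : seq H) (s : H) (M K : nat).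
Hypotheses (s1 : s != 1) (M_gt0 : (0 < M)%N).
Hypothesis SK : forall T, folner S M T -> (K <= #|` T|)%N.

Let S' : seq (Shuffler H) := switch 1 s :: [seq mover s | s <- S].

(** With [8 * M], small fibers and boundary together lose at most a quarter of [T], so [P] keeps at
    least half of [T']. Then K|F| <= 2|P|, while isoperimetry gives |P| <= 2|F| log |F|, whence the
    exponent 4. *)
Lemma shuffler_folner_size (T : {fset Shuffler H}) :
  folner S' (8 * M) T -> (2 ^ K <= #|` T| ^ 4)%N.
Proof.
case=> T0 TM; pose fib f := [fset t in T | shuf_perm t == f].
pose T' := [fset t in T | (K <= #|` fib (shuf_perm t)|)%N].
pose D := T `\` T'.
have T'P t : reflect (t \in T /\ (K <= #|` fib (shuf_perm t)|)%N) (t \in T').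
  by rewrite in_fset; apply: andP.
have DP t : reflect (t \in T /\ (#|` fib (shuf_perm t)| < K)%N) (t \in D).
  rewrite in_fsetD; apply: (iffP andP) => -[].
    move=> nt tT; split=> //; rewrite ltnNge; apply/negP => h.
    by move/negP: nt; apply; apply/T'P.
  by move=> tT h; split=> //; apply/T'P; rewrite leqNgt h => -[].
(* A nonempty fiber with fewer than [K] points is not [M]-Folner by [SK], so its size is at most [M]
   times its boundary, which the movers in [S'] detect inside [T]. *)
have hD : (#|` D| <= M * #|` boundary S' T|)%N.
  have hT t : t \in T -> shuf_perm t \in [fset shuf_perm u | u in T].
    by move=> tT; apply: in_imfset.
  rewrite (@card_fibers _ _ (@shuf_perm H) D [fset shuf_perm u | u in T]); last first.
    by move=> t /DP[/hT].
  rewrite (@card_fibers _ _ (@shuf_perm H) (boundary S' T) [fset shuf_perm u | u in T]); last first.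
    by move=> t /boundaryP[/hT].
  rewrite big_distrr /=; apply: leq_sum => f _.
  have [Kf|fK] := leqP K #|` fib f|.
    rewrite (_ : [fset t in D | _] = fset0) ?cardfs0 //.
    apply/fsetP => t; rewrite in_fset0 in_fset; apply/negP => /andP[/DP[tT lt] /eqP e].
    by move: lt; rewrite e ltnNge Kf.
  apply: (@leq_trans #|` fib f|).
    apply: fsubset_leq_card; apply/fsubsetP => t; rewrite !in_fset.
    by move=> /andP[/= /DP[tT _] e]; apply/andP.
  pose X := [fset shuf_pos t | t in fib f].
  have XP p : reflect ((Shuffle f p : Shuffler H) \in T) (p \in X).
    apply: (iffP idP) => [/imfsetP[[g q] /=]|h].
      by rewrite in_fset => /andP[/= gT /eqP <-] ->.
    by apply/imfsetP; exists (Shuffle f p) => //=; rewrite in_fset; apply/andP.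
  have cX : #|` X| = #|` fib f|.
    apply: card_in_imfset => -[g p] [g' p'] /=; rewrite !in_fset /=.
    by move=> /andP[_ /eqP/= ->] /andP[_ /eqP/= ->] ->.
  have [X0|X0] := eqVneq X fset0; first by rewrite -cX X0 cardfs0.
  have : ~ folner S M X by move/SK; rewrite cX leqNgt fK.
  rewrite -cX => nf; apply: (@leq_trans (M * #|` boundary S X|)).
    by rewrite leqNgt; apply/negP => lt; apply: nf; split=> //; apply: ltnW.
  rewrite leq_mul2l; apply/orP; right.
  apply: (leq_card_inj (f := fun p => Shuffle f p : Shuffler H)).
    by move=> p q _ _ [].
  move=> p /boundaryP[/XP pT [u uS pu]]; rewrite in_fset; apply/andP; split=> //=.
  apply/boundaryP; split=> //; exists (mover u).
    by rewrite in_cons map_f ?orbT.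
  by rewrite mul_mover /=; apply/negP => /XP; apply/negP.
pose F := [fset shuf_perm t | t in T'].
have hF : (K * #|` F| <= #|` T'|)%N.
  have hT t : t \in T' -> shuf_perm t \in F by move=> tT; apply: in_imfset.
  rewrite (card_fibers hT); apply: (@leq_trans (\sum_(f <- F) K)%N).
    by rewrite big_const_seq iter_addn addn0 count_predT.
  rewrite big_seq [leqRHS]big_seq; apply: leq_sum => _ /imfsetP[t /= /T'P[tT Kt] ->].
  apply: (leq_trans Kt); apply: fsubset_leq_card; apply/fsubsetP => u.
  rewrite !in_fset => /andP[/= uT /eqP e]; apply/andP; split; last exact/eqP.
  by apply/T'P; rewrite e; split.
pose P := [fset t in T' | t * switch 1 s \in T'].
have hP : (2 ^ #|` P| <= (#|` F| ^ #|` F|) ^ 2)%N.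
  apply: (edge_isoperimetry s1) => t; rewrite in_fset => /andP[/= tT tsT].
  by split; apply/imfsetP; [exists t | exists (t * switch 1 s)].
(* A point of [T'] outside [P] is sent by the switch either out of [T] or into [D]. *)
have hT' : (#|` T'| <= #|` P| + (#|` boundary S' T| + #|` D|))%N.
  pose D' := [fset t * (switch 1 s)^-1 | t in D].
  have sub : T' `<=` P `|` (boundary S' T `|` D').
    apply/fsubsetP => t tT'; rewrite !in_fsetU.
    have [tT _] := T'P _ tT'.
    have [tsT'|tsT'] := boolP (t * switch 1 s \in T').
      by apply/orP; left; rewrite in_fset; apply/andP.
    have [tsT|tsT] := boolP (t * switch 1 s \in T).
      apply/orP; right; apply/orP; right; apply/imfsetP => /=.
      by exists (t * switch 1 s); rewrite ?mulgK // in_fsetD tsT tsT'.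
    apply/orP; right; apply/orP; left; apply/boundaryP; split=> //.
    by exists (switch 1 s) => //; rewrite in_cons eqxx.
  have cD' : #|` D'| = #|` D| by apply: card_imfset; apply: mulIg.
  apply: leq_trans (fsubset_leq_card sub) _.
  apply: leq_trans (leq_card_fsetU _ _) _; rewrite leq_add2l -cD'.
  exact: leq_card_fsetU.
have TT' : (#|` T'| + #|` D| = #|` T|)%N.
  rewrite -(cardfsID T' T); congr addn.
  by have /fsetIidPr -> : T' `<=` T by apply: fset_sub.
have Tgt0 : (0 < #|` T|)%N by rewrite cardfs_gt0.
have F_gt0 : (0 < #|` F|)%N.
  have : (0 < #|` T'|)%N by nia.
  rewrite !cardfs_gt0 => /fset0Pn[t tT]; apply/fset0Pn; exists (shuf_perm t).
  exact: in_imfset.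
have FT : (#|` F| <= #|` T|)%N.
  apply: (@leq_trans #|` T'|); [exact: leq_imfset_card | lia].
(* Raising both sides to the power |F| brings the goal to the form of the isoperimetric bound. *)
apply: leq_trans (leq_expl 4 FT); rewrite -(leq_exp2r _ _ F_gt0).
rewrite -!expnM; apply: (@leq_trans (2 ^ (#|` P| * 2))%N).
  by rewrite leq_exp2l //; nia.
rewrite expnM; apply: leq_trans (leq_expl 2 hP) _.
by rewrite -!expnM leq_eqVlt; apply/orP; left; apply/eqP; congr (_ ^ _)%N; lia.
Qed.

End ShufflerLower.

Lemma folner_lower_Shuffler (H : groupType) (a k : nat) :
  (exists s : H, s != 1) -> folner_lower H a k -> folner_lower (Shuffler H) a k.+1.
Proof.
move=> [s s1] [S [C [C0 SC]]]; exists (switch 1 s :: [seq mover u | u <- S]).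
(* The factor 4 offsets the fourth power in [shuffler_folner_size]; [16 ^ a] accounts for passing
   from [N] to [N %/ 8]. *)
exists (C * (4 * 16 ^ a))%N; split; first by rewrite !muln_gt0 C0 expn_gt0.
move=> N T x x0 xN [T0 TN].
have N16 : (16 <= N)%N.
  case: a {SC} xN => [|a] xN; first by rewrite !expn0 in xN; nia.
  have : (16 ^ a.+1 <= N ^ a.+1)%N.
    apply: leq_trans _ xN; rewrite mulnAC.
    by have Cx : (0 < C * x)%N; [rewrite muln_gt0 C0 | nia].
  by rewrite leq_exp2r.
have : (2 ^ tower k (4 * x) <= #|` T| ^ 4)%N.
  apply: (shuffler_folner_size (S := S) (s := s) (M := N %/ 8)) => //; first by lia.
    move=> U UM; apply: SC UM; first by lia.
    have : (N ^ a <= 16 ^ a * (N %/ 8) ^ a)%N by rewrite -expnMn; apply: leq_expl; lia.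
    by have : (0 < 16 ^ a)%N by [rewrite expn_gt0]; nia.
  split=> //; apply: leq_trans TN; rewrite leq_mul2r; apply/orP; right; lia.
move=> h; rewrite -(@leq_exp2r _ _ 4) //=; apply: leq_trans h.
by rewrite -expnM leq_exp2l // mulnC; apply: muln_tower.
Qed.

(** * Upper bound: Folner sets of a lampshuffler from supported permutations *)

Lemma fsym_support_seq (T : choiceType) (f : FSym T) :
  exists s : seq T, forall x, x \notin s -> f x = x.
Proof.
have [s hs] := proj1 (finite_seqP _) (fsym_fin f); exists s => x xs.
apply: contrapT => nx; move/negP: xs; apply.
by change ([set` s]%classic x); rewrite -hs.
Qed.

(** A permutation supported in [X] preserves [X], so it is encoded by a self-map of [X]. *)
Lemma fsym_supported (T : choiceType) (X : {fset T}) : exists Q : {fset FSym T},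
  (forall f : FSym T, f \in Q <-> forall x, x \notin X -> f x = x) /\
  (#|` Q| <= #|` X| ^ #|` X|)%N.
Proof.
pose supp (f : FSym T) := `[< forall x, x \notin X -> f x = x >].
(* The default value [u] of [insubd] is never reached when [f] is supported in [X]. *)
pose code (f : FSym T) := [ffun u : X => insubd u (f (val u))].
have codeI f g : supp f -> supp g -> code f = code g -> f = g.
  move=> /asboolP sf /asboolP sg fg; apply: fsymP => x.
  have stab (h : FSym T) (y : T) : (forall x, x \notin X -> h x = x) -> y \in X -> h y \in X.
    move=> sh yX; apply/negPn/negP => hyX; move: (hyX).
    by rewrite (bij_inj (fsym_bij h) (sh _ hyX)) yX.
  have [xX|xX] := boolP (x \in X); last by rewrite sf ?sg.
  have /(congr1 val) := congr1 (fun c : {ffun X -> X} => c [` xX]) fg.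
  by rewrite !ffunE !val_insubd /= !stab.
pose dec (c : {ffun X -> X}) : FSym T :=
  if pselect (exists f, supp f /\ code f = c) is left h then sval (cid h) else 1.
have decK f : supp f -> dec (code f) = f.
  move=> sf; rewrite /dec; case: pselect => [h|]; last by case; exists f.
  by case: cid => g /= [sg]; apply: codeI.
exists [fset f in [fset dec c | c : {ffun X -> X}] | supp f]; split=> [f|].
  split=> [|/asboolP sf]; first by rewrite in_fset => /andP[_ /asboolP].
  by rewrite in_fset; apply/andP; split=> //; apply/imfsetP; exists (code f); rewrite ?decK.
apply: leq_trans (fsubset_leq_card (fset_sub _ _)) _.
apply: leq_trans (leq_imfset_card _ _ _) _.
have E : #|{ffun X -> X}| = (#|` X| ^ #|` X|)%N by rewrite card_ffun -cardfE.
rewrite -E cardE; apply: uniq_leq_size; first exact: enum_finmem_uniq.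
by move=> c _; rewrite mem_enum.
Qed.

(** With [t = tower k y] this reduces to [t * 2 * 2 ^ t <= 2 ^ (2 * t)]: a single exponential
    already absorbs the logarithmic loss of a lampshuffler step, which is why the tower has height
    at least 1. *)
Lemma expn_tower k y : (0 < y)%N ->
  (tower k.+1 y ^ (2 * tower k.+1 y) <= tower k.+2 (2 * y))%N.
Proof.
move=> y0; rewrite /= -expnM leq_exp2l //.
apply: (@leq_trans (2 ^ (2 * tower k y))); last by rewrite leq_exp2l ?muln_tower.
have t0 : (0 < tower k y)%N by apply: leq_trans (tower_ge k y).
rewrite [(2 * tower k y)%N]mul2n -addnn expnD mulnA leq_mul2r; apply/orP; right.
by case: (tower k y) t0 => // n _; rewrite mulnC expnS leq_mul2l /= ltn_expl.
Qed.

Section ShufflerUpper.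
Variable H : groupType.

(** A pair can leave the set only if its position lies in the boundary of [T0]; the number of
    permutations is a common factor of size and boundary, so the Folner ratio is inherited. *)
Lemma folner_Shuffler (S : seq (Shuffler H)) : exists S0 : seq H,
  forall N T0, folner S0 N T0 -> exists T, folner S N T /\
    (#|` T| <= #|` T0| ^ (2 * #|` T0|))%N.
Proof.
have /boolp.choice[supp suppP] (u : Shuffler H) := fsym_support_seq (shuf_perm u).
(* The supports of the generators are included besides their positions: if [p] translates the
   support of [g] into [T0], then [f * fsym_act p g] is still supported in [T0]. *)
exists ([seq shuf_pos u | u <- S] ++ flatten [seq supp u | u <- S]).
set S0 := _ ++ _; move=> N T0 [T00 T0N].
have [Q [QP Qc]] := fsym_supported T0.
pose mk f p : Shuffler H := Shuffle f p.
pose T : {fset Shuffler H} := [fset mk f p | f in Q, p in T0].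
have mkP A f p : reflect (f \in Q /\ p \in A) (mk f p \in [fset mk f p | f in Q, p in A]).
  apply: (iffP idP) => [/imfset2P[f' /= fQ [p' /= pT [-> ->]]]|[fQ pT]] //.
  by apply/imfset2P; exists f => //; exists p.
have cT (A : {fset H}) : #|` [fset mk f p | f in Q, p in A] | = (#|` Q| * #|` A|)%N.
  rewrite (@card_fibers _ _ (@shuf_perm H) _ Q); last by move=> [f p] /mkP[].
  rewrite -(count_predT Q) -sum1_count big_distrl /= big_seq [RHS]big_seq.
  apply: eq_bigr => f fQ; rewrite mul1n; symmetry.
  have <- : #|` [fset mk f p | p in A] | = #|` A| by apply: card_imfset => p q [].
  congr (#|` _|); apply/fsetP => -[g p]; rewrite in_fset; apply/imfsetP/andP => /=.
    by move=> [q qA [-> ->]]; split=> //; apply/mkP.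
  by move=> [/mkP[gQ pA] /eqP <-]; exists p.
exists [fset mk f p | f in Q, p in T0]; split; last first.
  rewrite cT mul2n -addnn expnD; apply: leq_mul => //.
  by move: T00; rewrite -cardfs_gt0; case: #|` T0| => // n _; rewrite -{1}(expn1 n.+1) leq_pexp2l.
have Q1 : 1 \in Q by apply/QP.
split.
  have /fset0Pn[p pT0] := T00; apply/fset0Pn; exists (mk 1 p); exact/mkP.
rewrite cT; apply: (@leq_trans (N * (#|` Q| * #|` boundary S0 T0|))).
  rewrite leq_mul2l -cT; apply/orP; right; apply: fsubset_leq_card.
  apply/fsubsetP => -[f p] /boundaryP[/mkP[fQ pT0] [u uS ut]].
  apply/mkP; split=> //; apply/negPn/negP => npb; move/negP: ut; apply.
  have stay v : v \in S0 -> p * v \in T0.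
    move=> vS; apply/negPn/negP => pv; move/negP: npb; apply.
    by apply/boundaryP; split=> //; exists v.
  case: u uS => g q uS; rewrite mul_shuffleE; apply/mkP; split; last first.
    by apply: stay; rewrite mem_cat (map_f (@shuf_pos H) uS).
  apply/QP => x xT0; change (f (p * g (p^-1 * x)) = x).
  rewrite (suppP (Shuffle g q)) ?mulVKg; first exact: (proj1 (QP f)).
  apply: contra xT0 => xs; rewrite -(mulVKg p x); apply: stay.
  rewrite mem_cat; apply/orP; right; apply/flattenP.
  by exists (supp (Shuffle g q)) => //; apply: map_f.
by rewrite mulnCA leq_mul2l T0N orbT.
Qed.

Lemma folner_upper_Shuffler (a k : nat) :
  folner_upper H a k.+1 -> folner_upper (Shuffler H) a k.+2.
Proof.
move=> HU S; have [S0 S0P] := folner_Shuffler S; have [C C0 CP] := HU S0.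
exists (2 * C)%N; first by rewrite muln_gt0.
move=> l; have [T0 [fT0 cT0]] := CP l.
have [T [fT cT]] := S0P _ _ fT0; exists T; split=> //.
apply: leq_trans cT _; set y := (C * _)%N in cT0.
have T0_gt0 : (0 < #|` T0|)%N by rewrite cardfs_gt0; case: fT0.
have y0 : (0 < y)%N by rewrite !muln_gt0 C0 expn_gt0.
rewrite -mulnA -/y; apply: leq_trans (expn_tower k y0).
apply: (@leq_trans (tower k.+1 y ^ (2 * #|` T0|))); first exact: leq_expl.
by rewrite leq_pexp2l ?expn_gt0 // leq_mul2l.
Qed.
End ShufflerUpper.

(** * Folner sets from polynomial growth *)

Section WordBalls.
Variable G : groupType.
Implicit Types (S : set G) (g h : G).

Lemma word_ball1 S n : word_ball S n 1.
Proof. by exists [::]; split=> //; rewrite big_nil. Qed.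

Lemma word_ball_gen S s : S s \/ S s^-1 -> word_ball S 1 s.
Proof.
move=> sS; exists [:: s]; split=> //; last by rewrite big_seq1.
by move=> x; rewrite inE => /eqP ->.
Qed.

Lemma leq_word_ball S m n g : (m <= n)%N -> word_ball S m g -> word_ball S n g.
Proof. by move=> mn [w [wm wS ->]]; exists w; split=> //; apply: leq_trans mn. Qed.

Lemma word_ballM S m n g h :
  word_ball S m g -> word_ball S n h -> word_ball S (m + n) (g * h).
Proof.
move=> [v [vm vS ->]] [w [wn wS ->]]; exists (v ++ w); split.
- by rewrite size_cat leq_add.
- by move=> x; rewrite mem_cat => /orP[/vS|/wS].
- by rewrite big_cat.
Qed.

Lemma word_ballS S n g : word_ball S n.+1 g ->
  g = 1 \/ exists s h, [/\ S s \/ S s^-1, word_ball S n h & g = s * h].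
Proof.
move=> [[|s w] [wn wS ->]]; first by left; rewrite big_nil.
right; exists s, (\prod_(x <- w) x); split; first exact/wS/mem_head.
  by exists w; split=> // x xw; apply: wS; rewrite in_cons xw orbT.
by rewrite big_cons.
Qed.

Lemma word_ballV S n g : word_ball S n g -> word_ball S n g^-1.
Proof.
elim: n g => [|n IH] g.
  by move=> [[|? ?] [w0 _ ->]] //; rewrite big_nil invg1; apply: word_ball1.
case/word_ballS => [->|[s [h [sS /IH hn ->]]]]; first by rewrite invg1; apply: word_ball1.
rewrite invgM -addn1; apply: word_ballM hn _; apply: word_ball_gen.
by rewrite invgK; case: sS; [right | left].
Qed.

Lemma symmetric_seq S : finite_set S ->
  exists s0 : seq G, forall s, S s \/ S s^-1 -> s \in s0.
Proof.
move=> fS; have [s0 hS] := proj1 (finite_seqP _) fS.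
exists (s0 ++ [seq s^-1 | s <- s0]) => s; rewrite hS mem_cat => -[/= -> //|/= h].
by apply/orP; right; rewrite -[s]invgK map_f.
Qed.

Lemma finite_word_ball S n : finite_set S -> finite_set (word_ball S n).
Proof.
move=> fS; elim: n => [|n IH].
  apply: sub_finite_set (finite_set1 1) => g [[|? ?] [w0 _ ->]] //.
  by rewrite big_nil.
have fV : finite_set ((fun s : G => s^-1) @` S)%classic by apply: finite_image.
have fSS : finite_set (S `|` (fun s : G => s^-1) @` S)%classic by rewrite finite_setU.
have f2 := finite_image2 (fun s h : G => s * h) fSS IH.
have f1 : finite_set ([set 1] `|`
    [set s * h | s in (S `|` (fun s : G => s^-1) @` S) & h in word_ball S n])%classic.
  by rewrite finite_setU; split=> //; apply: finite_set1.
apply: sub_finite_set f1 => g /word_ballS[->|[s [h [sS hn ->]]]]; first by left.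
right; exists s; last by exists h.
by case: sS => sS; [left | right; exists s^-1; rewrite ?invgK].
Qed.

Definition ball S n : {fset G} := fset_set (word_ball S n).

Lemma ballP S n g : finite_set S -> g \in ball S n <-> word_ball S n g.
Proof. by move=> fS; rewrite in_fset_set ?inE //; apply: finite_word_ball. Qed.

Lemma word_ball_seq S (s : seq G) : finite_generating_set S ->
  exists2 q, (0 < q)%N & forall x, x \in s -> word_ball S q x.
Proof.
move=> [_ gS]; elim: s => [|x s [q q0 IH]]; first by exists 1%N.
have [n xn] := gS x; exists (q + n)%N; first by rewrite addn_gt0 q0.
move=> y; rewrite in_cons => /orP[/eqP ->|/IH].
  by apply: leq_word_ball xn; apply: leq_addl.
by apply: leq_word_ball; apply: leq_addr.
Qed.

Lemma leq_ball S m n : finite_set S -> (m <= n)%N -> ball S m `<=` ball S n.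
Proof.
by move=> fS mn; apply/fsubsetP => g; rewrite !ballP //; apply: leq_word_ball.
Qed.

(** An integer form of [has_growth_degree], keeping the estimates in [nat]. *)
Definition growth_bounds S a C := (0 < C)%N /\ forall n, (0 < n)%N ->
  (n ^ a <= C * #|` ball S n|)%N /\ (#|` ball S n| <= C * n ^ a)%N.

Lemma growth_degreeP (R : realType) a : has_growth_degree G R a ->
  exists S C, finite_generating_set S /\ growth_bounds S a C.
Proof.
move=> [S gS [C C0 h]]; exists S, (Num.bound C); split=> //.
have CB : (C <= (Num.bound C)%:R)%R.
  exact/ltW/archi_boundP/ltW.
split; first by rewrite -(ltr_nat R) (lt_le_trans C0).
move=> n n0; have /andP[h1 h2] := h n n0; split; rewrite -(ler_nat R) natrM natrX.
  apply: (@le_trans _ _ (C * (growth_function S n)%:R)%R); last by rewrite ler_wpM2r ?ler0n.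
  by rewrite -ler_pdivrMl.
by apply: le_trans h2 _; rewrite ler_wpM2r ?exprn_ge0 ?ler0n.
Qed.

End WordBalls.

Section GrowthFolner.
Variables (G : groupType) (S : set G) (a C : nat).
Hypotheses (gS : finite_generating_set S) (SC : growth_bounds S a C).

(* Pigeonhole: doubling the radius multiplies the size of a ball by at most
   [C ^ 2 * 2 ^ a], so the size cannot grow by a factor [1 + 2 ^ -l] at each of
   [C ^ 2 * 2 ^ (a + l)] intermediate steps. *)
Lemma growth_folner_balls (S' : seq G) : exists2 C', (0 < C')%N &
  forall l, exists T, folner S' (2 ^ l) T /\ (#|` T| <= C' * 2 ^ (a * l))%N.
Proof.
have [fS _] := gS; have [C0 bC] := SC; have [q q0 qS] := word_ball_seq S' gS.
pose D := (C * C * 2 ^ a)%N; have D0 : (0 < D)%N by rewrite !muln_gt0 C0 expn_gt0.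
exists (C * (2 * q * D) ^ a)%N.
  by rewrite muln_gt0 C0 expn_gt0 muln_gt0 D0 andbT muln_gt0 q0.
move=> l; pose n := (D * 2 ^ l)%N; pose b i := #|` ball S (q * i)|.
have n0 : (0 < n)%N by rewrite muln_gt0 D0 expn_gt0.
have bS i j : (i <= j)%N -> (b i <= b j)%N.
  by move=> ij; apply/fsubset_leq_card/leq_ball; rewrite ?leq_mul2l ?ij ?orbT.
have [i [ni bi]] : exists i, (n <= i < n + n)%N /\ (2 ^ l * (b i.+1 - b i) <= b i.+1)%N.
  apply: contrapT => hn.
  (* Each failing step adds at least [b n] divided by [2 ^ l], so [n = D * 2 ^ l] steps add
     [D * b n], against the doubling bound. *)
  have step j : (j <= n)%N -> (2 ^ l * b n + j * b n <= 2 ^ l * b (n + j)%N)%N.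
    elim: j => [|j IH] jn; first by rewrite addn0 mul0n addn0.
    have lt : (b (n + j).+1 < 2 ^ l * (b (n + j).+1 - b (n + j)))%N.
      by rewrite ltnNge; apply/negP => le; apply: hn; exists (n + j)%N; split=> //; lia.
    have le1 := bS _ _ (leqnSn (n + j)); have le2 := bS n (n + j).+1 ltac:(lia).
    rewrite addnS; move: lt (IH ltac:(lia)); rewrite mulnBr.
    have := leq_mul (leqnn (2 ^ l)) le1; lia.
  have := step n (leqnn n); rewrite {2}/n => h.
  have h1 : ((1 + D) * b n <= b (n + n)%N)%N.
    by rewrite -(@leq_pmul2l (2 ^ l)) ?expn_gt0 //; apply: leq_trans h; lia.
  have [_ h2] := bC (q * (n + n))%N ltac:(lia); have [h3 _] := bC (q * n)%N ltac:(lia).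
  have E : ((q * (n + n)) ^ a = 2 ^ a * (q * n) ^ a)%N by rewrite -expnMn; congr (_ ^ _)%N; lia.
  rewrite -/(b n) in h3; rewrite -/(b (n + n)%N) E in h2.
  have bn0 : (0 < b n)%N.
    rewrite cardfs_gt0; apply/fset0Pn; exists 1; apply/ballP => //.
    exact: word_ball1.
  have : (b (n + n)%N <= D * b n)%N.
    apply: leq_trans h2 _; rewrite /D -!mulnA leq_mul2l.
    by rewrite mulnCA leq_mul2l h3 !orbT.
  by rewrite leqNgt => /negP; apply; apply: leq_trans h1; lia.
exists (ball S (q * i.+1)); split.
  split.
    by apply/fset0Pn; exists 1; apply/ballP => //; apply: word_ball1.
  apply: leq_trans bi; rewrite leq_mul2l; apply/orP; right.
  (* [S'] moves a point of the ball of radius [q * i] by at most [q], so the boundary lies in the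
     last shell. *)
  have sub := leq_ball fS (leq_mul (leqnn q) (leqnSn i)).
  rewrite -(cardfsDS sub); apply: fsubset_leq_card; apply/fsubsetP => t.
  move=> /boundaryP[tT [s sS ts]]; rewrite in_fsetD tT andbT.
  apply: contra ts => /ballP ti; apply/ballP => //.
  by rewrite mulnS addnC; apply: word_ballM (ti fS) (qS _ sS).
apply: (@leq_trans (b (n + n)%N)); first by apply: bS; lia.
have [_ h] := bC (q * (n + n))%N ltac:(lia); apply: leq_trans h _.
have -> : (q * (n + n) = 2 * q * D * 2 ^ l)%N by rewrite /n; lia.
by rewrite expnMn -expnM [(l * a)%N]mulnC mulnA.
Qed.

Lemma growth_folner_upper0 : folner_upper G a 0.
Proof.
move=> S'; have [C' C'0 h] := growth_folner_balls S'; exists C' => // l.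
have [T [fT cT]] := h l; exists T; split=> //; apply: leq_trans cT _.
by rewrite /= leq_mul2l leq_pmulr ?orbT.
Qed.

(** No exponential is present yet to absorb the logarithm of |T0|; it is at most [C' + a * l] and
    becomes the factor [l.+1] in [folner_upper]. *)
Lemma growth_folner_upper1 : folner_upper (Shuffler G) a 1.
Proof.
move=> S'; have [S0 S0P] := folner_Shuffler S'.
have [C' C'0 h] := growth_folner_balls S0.
exists (2 * C' * (C' + a))%N; first by rewrite !muln_gt0 C'0 addn_gt0 C'0.
move=> l; have [T0 [fT0 cT0]] := h l; have [T [fT cT]] := S0P _ _ fT0.
exists T; split=> //; apply: leq_trans cT _.
have T0_gt0 : (0 < #|` T0|)%N by rewrite cardfs_gt0; case: fT0.
apply: (@leq_trans ((2 ^ (C' + a * l)) ^ (2 * (C' * 2 ^ (a * l))))%N).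
  apply: (@leq_trans ((2 ^ (C' + a * l)) ^ (2 * #|` T0|))%N).
    apply: leq_expl; apply: leq_trans cT0 _; rewrite expnD leq_mul2r.
    by rewrite ltnW ?orbT // ltn_expl.
  by rewrite leq_pexp2l ?expn_gt0 // leq_mul2l.
rewrite -expnM leq_exp2l //; set z := (2 ^ _)%N.
have : ((C' + a * l) <= (C' + a) * l.+1)%N by nia.
move/(leq_mul (leqnn (2 * (C' * z))%N)); lia.
Qed.

(** A point that exits under [g] exits at one of the at most [n] letters of a word for [g], and
    translations are injective. *)
Lemma translate_exits (S' : seq G) (T : {fset G}) n g : (forall s, S s \/ S s^-1 -> s \in S') ->
  word_ball S n g -> (#|` [fset t in T | (t * g)%g \notin T]| <= n * #|` boundary S' T|)%N.
Proof.
move=> SS'; elim: n g => [|n IH] g.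
  move=> [[|? ?] [w0 _ ->]] //; rewrite big_nil leqn0 cardfs_eq0; apply/eqP/fsetP => t.
  by rewrite in_fset in_fset0; apply/negP => /andP[/= tT]; rewrite mulg1 tT.
case/word_ballS => [->|[s [h [/SS' sS hn ->]]]].
  rewrite [X in (X <= _)%N](_ : _ = 0%N) //; apply/eqP; rewrite cardfs_eq0; apply/eqP/fsetP => t.
  by rewrite in_fset in_fset0; apply/negP => /andP[/= tT]; rewrite mulg1 tT.
pose B := [fset t * s^-1 | t in [fset t in T | (t * h)%g \notin T]].
have cB : #|` B| = #|` [fset t in T | (t * h)%g \notin T]| by apply: card_imfset; apply: mulIg.
rewrite mulSn; apply: leq_trans (leq_add (leqnn _) (IH h hn)); rewrite -cB.
apply: leq_trans (leq_card_fsetU _ _); apply: fsubset_leq_card.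
apply/fsubsetP => t; rewrite in_fset in_fsetU => /andP[/= tT tsh].
have [tsT|tsT] := boolP (t * s \in T); last first.
  by apply/orP; left; apply/boundaryP; split=> //; exists s.
apply/orP; right; apply/imfsetP; exists (t * s); rewrite ?mulgK //=.
by rewrite in_fset; apply/andP; rewrite -mulgA.
Qed.

(* Coulhon--Saloff-Coste: averaged over the ball, a translate of [T] meets [T]
   in at most [#|T|^2 / #|ball|] points, but in at least half of [T] by
   [translate_exits]. *)
Lemma ball_folner (S' : seq G) (T : {fset G}) N r : (forall s, S s \/ S s^-1 -> s \in S') ->
  (2 * r <= N)%N -> folner S' N T -> (#|` ball S r| <= 2 * #|` T|)%N.
Proof.
move=> SS' rN [T0 TN]; have [fS _] := gS.
rewrite -(@leq_pmul2l #|` T|) ?cardfs_gt0 //.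
(* Double counting: for fixed [t], the elements [g] with [t * g] in [T] inject into [T]. *)
have h1 : (\sum_(g <- ball S r) #|` [fset t in T | (t * g)%g \in T]| <= #|` T| * #|` T|)%N.
  under eq_bigr do rewrite card_fset_sep.
  rewrite exchange_big /=; apply: (@leq_trans (\sum_(t <- T) #|` T|)%N).
    apply: leq_sum => t _.
    rewrite -(card_fset_sep (fun g => t * g \in T)).
    apply: (leq_card_inj (f := fun g => t * g)) => [g g' _ _|g]; first exact: mulgI.
    by rewrite in_fset => /andP[].
  by rewrite big_const_seq iter_addn addn0 count_predT.
(* At most [r] times the boundary exits under [g], hence at most half of [T]. *)
have h2 : (#|` T| * #|` ball S r| <=
    2 * \sum_(g <- ball S r) #|` [fset t in T | (t * g)%g \in T]|)%N.
  rewrite big_distrr /=; apply: (@leq_trans (\sum_(g <- ball S r) #|` T|)%N).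
    by rewrite big_const_seq iter_addn addn0 count_predT.
  rewrite big_seq [leqRHS]big_seq; apply: leq_sum => g /(ballP _ _ fS) gr.
  have ex := translate_exits T SS' gr.
  have : (#|` T| <= #|` [fset t in T | (t * g)%g \in T]|
      + #|` [fset t in T | (t * g)%g \notin T]|)%N.
    apply: leq_trans (leq_card_fsetU _ _); apply: fsubset_leq_card; apply/fsubsetP => t tT.
    rewrite in_fsetU !in_fset; apply/orP.
    by have [h|h] := boolP (t * g \in T); [left | right]; apply/andP.
  have lt := leq_mul rN (leqnn #|` boundary S' T|); move: TN ex lt.
  move: #|` [fset t in T | (t * g)%g \in T]| #|` [fset t in T | (t * g)%g \notin T]|.
  move: #|` boundary S' T| #|` T|; lia.
lia.
Qed.

Lemma growth_folner_lower : folner_lower G a 0.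
Proof.
have [fS _] := gS; have [C0 bC] := SC; have [S' S'P] := symmetric_seq fS.
(* [ball_folner] is used at radius [N %/ 2], and [N <= 4 * (N %/ 2)] accounts for [4 ^ a]. *)
exists S', (2 * C * 4 ^ a)%N.
split; first by rewrite !muln_gt0 C0 expn_gt0.
move=> N T x x0 xN fT /=.
have N4 : (4 <= N)%N.
  case: a xN {bC} => [|a'] xN; first by rewrite !expn0 in xN; nia.
  have : (4 ^ a'.+1 <= N ^ a'.+1)%N.
    apply: leq_trans _ xN; rewrite mulnAC.
    by have Cx : (0 < 2 * C * x)%N; [rewrite !muln_gt0 C0 | nia].
  by rewrite leq_exp2r.
have := @ball_folner _ T N (N %/ 2) S'P ltac:(lia) fT.
have [h _] := bC (N %/ 2)%N ltac:(lia).
have h1 : (N ^ a <= 4 ^ a * (N %/ 2) ^ a)%N by rewrite -expnMn; apply: leq_expl; lia.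
move=> h2; have : (N ^ a <= 4 ^ a * (C * (2 * #|` T|)))%N.
  apply: leq_trans h1 _; rewrite leq_mul2l; apply/orP; right.
  by apply: leq_trans h _; rewrite leq_mul2l h2 orbT.
have p : (0 < 2 * C * 4 ^ a)%N by rewrite !muln_gt0 C0 expn_gt0.
move/(leq_trans xN) => h3; rewrite -(leq_pmul2l p); apply: leq_trans h3 _.
by move: #|` T| (4 ^ a)%N => u v; rewrite leq_eqVlt; apply/orP; left; apply/eqP; lia.
Qed.

End GrowthFolner.

(** * Coarse invariance *)

Lemma folner_exponents (G : groupType) a b n m : (0 < a)%N ->
  folner_lower G a n -> folner_upper G b m -> (n < m)%N \/ n = m /\ (a <= b)%N.
Proof.
move=> a0 [S [C [C0 low]]] /(_ S)[C' C'0 up].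
have key l x : (0 < x)%N -> (C * x <= 2 ^ (a * l))%N ->
    (tower n x <= tower m (C' * (2 ^ (b * l) * l.+1)))%N.
  move=> x0 xl; have [T [fT cT]] := up l; apply: leq_trans cT.
  by apply: low fT => //; rewrite -expnM [(l * a)%N]mulnC.
have [nm|mn|nm] := ltngtP n m; first by left.
  have [l hl] := linear_le_exp2 (C * (b + 1)) (C * (C' + 1)).
  (* Chosen so that [2 ^ x] exceeds the upper bound factor by factor, while [C * x] stays linear in
     [l]. *)
  pose x := (C' + b * l + l.+1)%N.
  have := key l x ltac:(lia); rewrite -(subnKC mn) addSnnS towerD leq_tower => h.
  have : (2 ^ x <= C' * (2 ^ (b * l) * l.+1))%N.
    apply: leq_trans (h _); first by rewrite /= leq_exp2l // tower_ge.
    apply: leq_trans (_ : 2 ^ l <= _)%N; last by rewrite leq_exp2l // leq_pmull.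
    by apply: leq_trans hl; rewrite /x; nia.
  rewrite leqNgt => /negP[]; rewrite /x !expnD -mulnA.
  apply: ltn_mul; first exact: ltn_expl.
  by rewrite ltn_pmul2l ?expn_gt0 // ltn_expl.
right; split=> //; rewrite leqNgt; apply/negP => ba; subst m.
have [l hl] := linear_le_exp2 (C * C') (C * (C' + 1)).
(* One more than the upper bound. As [b < a], there is a spare factor [2 ^ l] that dominates [C] and
   [l.+1]. *)
pose x := (C' * (2 ^ (b * l) * l.+1)).+1.
have := key l x isT; rewrite leq_tower ltnn => h.
suff : false by []; apply: h; apply: (@leq_trans (2 ^ (b * l) * 2 ^ l)%N).
  have p : (0 < 2 ^ (b * l))%N by rewrite expn_gt0.
  apply: leq_trans (leq_mul (leqnn _) hl); rewrite /x; move: (2 ^ _)%N p => z z0.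
  have : (C <= C * z)%N by rewrite leq_pmulr.
  lia.
by rewrite -expnD leq_exp2l // -mulSnr leq_mul2r ba orbT.
Qed.

Section Coarse.
Variables G H : groupType.
Implicit Types f : G -> H.

(** Bounded distance is expressed by letting [g^-1 * g'] range over a finite list, so these coarse
    notions involve no generating set. *)
Definition bornologous f := forall S : seq G, exists S' : seq H,
  forall g s, s \in S -> (f g)^-1 * f (g * s) \in S'.

Definition coarsely_proper f := forall S' : seq H, exists S : seq G,
  forall g g', (f g)^-1 * f g' \in S' -> g^-1 * g' \in S.

Definition coarsely_onto f := exists P : seq H,
  forall y, exists x, (f x)^-1 * y \in P.

Definition coarse_equivalence f :=
  [/\ bornologous f, coarsely_proper f & coarsely_onto f].

End Coarse.

Lemma coarse_equivalence_sym (G H : groupType) (f : G -> H) :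
  coarse_equivalence f -> exists f' : H -> G, coarse_equivalence f'.
Proof.
move=> [fb fp [P /boolp.choice[f' f'P]]]; exists f'; split=> [S|S'|].
- have [S' S'P] := fp [seq p * t | p <- P, t <- [seq s * p^-1 | s <- S, p <- P]].
  exists S' => y s sS; apply: S'P.
  have -> : (f (f' y))^-1 * f (f' (y * s)) =
      ((f (f' y))^-1 * y) * (s * ((f (f' (y * s)))^-1 * (y * s))^-1).
    by rewrite !invgM invgK !mulgA !mulgK.
  by apply: allpairs_f; [apply: f'P | apply: allpairs_f; [|apply: f'P]].
- have [S'' S''P] := fb S'.
  exists [seq p^-1 * t | p <- P, t <- [seq s * p | s <- S'', p <- P]] => y y' yy'.
  have -> : y^-1 * y' = ((f (f' y))^-1 * y)^-1 *
      (((f (f' y))^-1 * f (f' y')) * ((f (f' y'))^-1 * y')).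
    by rewrite invgM invgK -!mulgA !mulVKg.
  apply: (allpairs_f (fun p t => p^-1 * t)); first exact: f'P.
  apply: allpairs_f; last exact: f'P.
  by rewrite -[f' y'](mulVKg (f' y)); apply: S''P.
- have [S SP] := fp P; exists S => x; exists (f x); exact/SP/f'P.
Qed.

(** A Folner set [T] of [H] is pulled back to the points whose image is [P]-close to [T]. Coarse
    surjectivity bounds its size from below, properness bounds the fibers of [f], and bornology
    sends its boundary near that of [T]. *)
Lemma folner_upper_coarse (G H : groupType) (f : G -> H) a k :
  coarse_equivalence f -> folner_upper H a k -> folner_upper G a k.
Proof.
move=> [fb fp [P0 P0P]] up S; pose P := 1 :: P0.
have [U UP] := fb S; have [Q QP] := fp [:: 1].
(* [x0] picks one point in each fiber of [f]; by [QP] the whole fiber lies in its translates by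
   [Q]. *)
have [x0 x0P] : exists x0 : H -> G, forall x, f (x0 (f x)) = f x.
  have /boolp.choice[x0 x0P] : forall y, exists x, (exists x', f x' = y) -> f x = y.
    by move=> y; have [[x fx]|nx] := pselect (exists x', f x' = y); [exists x | exists 1].
  by exists x0 => x; apply: x0P; exists x.
pose L (Y : {fset H}) := [seq x0 z * q | z <- [seq y * p^-1 | y <- enum_fset Y, p <- P], q <- Q].
have sL Y : size (L Y) = (#|` Y| * size P * size Q)%N by rewrite !size_allpairs.
have inL Y x p : p \in P -> f x * p \in Y -> x \in L Y.
  move=> pP xY; rewrite -(mulVKg (x0 (f x)) x); apply: (allpairs_f (fun z q => x0 z * q)).
    by rewrite -[f x](mulgK p); apply: (allpairs_f (fun y p => y * p^-1)).
  by apply: QP; rewrite x0P mulVg mem_head.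
pose W := [seq p^-1 * u | p <- P, u <- U]; have [C C0 CP] := up W.
(* [T] will be [2 ^ (l + c)]-Folner, the factor [2 ^ c] paying for the multiplicities of the
   pull-back. *)
have [c hc] : exists c, (size P * size P * size Q <= 2 ^ c)%N.
  by exists (size P * size P * size Q)%N; apply/ltnW/ltn_expl.
have Q0 : (0 < size Q)%N.
  have := QP 1 1; rewrite mulVg mem_head => /(_ isT); by case: (Q).
exists (size P * size Q * (C * 2 ^ (a * c) * c.+1))%N.
  by rewrite !muln_gt0 Q0 C0 expn_gt0.
move=> l; have [T [[T0 TN] cT]] := CP (l + c)%N.
pose T' := [fset x in L T | has (fun p => f x * p \in T) P].
have T'P x : reflect (exists2 p, p \in P & f x * p \in T) (x \in T').
  apply: (iffP idP) => [|[p pP xp]]; first by rewrite in_fset => /andP[_ /hasP].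
  rewrite in_fset; apply/andP; split; first exact: inL xp.
  by apply/hasP; exists p.
have cT' : (#|` T'| <= #|` T| * size P * size Q)%N.
  by rewrite -sL; apply: leq_card_seq => x /T'P[p]; apply: inL.
have cTT' : (#|` T| <= size P * #|` T'|)%N.
  rewrite mulnC -(size_allpairs (fun x p => f x * p)).
  apply: leq_card_seq => y yT; have [x xy] := P0P y.
  rewrite -(mulVKg (f x) y); have xyP : (f x)^-1 * y \in P by rewrite in_cons xy orbT.
  apply: (allpairs_f (fun x p => f x * p)) => //.
  by apply/T'P; exists ((f x)^-1 * y) => //; rewrite mulVKg.
have bT' : (#|` boundary S T'| <= #|` boundary W T| * size P * size Q)%N.
  rewrite -sL; apply: leq_card_seq => x /boundaryP[/T'P[p pP xp] [s sS xs]].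
  apply: (inL _ _ p pP); apply/boundaryP; split=> //.
  exists (p^-1 * ((f x)^-1 * f (x * s))); first by apply: allpairs_f => //; apply: UP.
  rewrite mulgA mulgK mulVKg; apply: contra xs => xsT; apply/T'P; exists 1 => //.
    exact: mem_head.
  by rewrite mulg1.
exists T'; split; first split.
- by rewrite -cardfs_gt0; move: T0; rewrite -cardfs_gt0; nia.
- rewrite -(@leq_pmul2l (size P)) //; apply: leq_trans cTT'; apply: leq_trans TN.
  rewrite expnD; move: bT' hc.
  move: #|` boundary S T'| #|` boundary W T| (2 ^ l)%N (2 ^ c)%N (size P) (size Q).
  move=> u v z w p q h1 h2; have := leq_mul (leqnn (p * z)%N) h1.
  have := leq_mul (leqnn (z * v)%N) h2; lia.
- apply: leq_trans cT' _; rewrite -mulnA mulnC.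
  apply: (@leq_trans (tower k (size P * size Q * (C * (2 ^ (a * (l + c)) * (l + c).+1))))%N).
    apply: leq_trans (muln_tower _ _ _); first by rewrite leq_mul2l cT orbT.
    by rewrite !muln_gt0 C0 expn_gt0.
  rewrite leq_tower mulnDr expnD -!mulnA !leq_mul2l; do 3 (apply/orP; right).
  rewrite mulnCA leq_mul2l; apply/orP; right; rewrite mulnCA leq_mul2l; apply/orP; right. nia.
Qed.

Lemma word_lengthP (G : groupType) (S : set G) g n : finite_generating_set S ->
  (word_length S g <= n)%N <-> word_ball S n g.
Proof.
move=> [_ gS]; rewrite /word_length; case: pselect => [h|nh]; last first.
  by case: nh; have [m mg] := gS g; exists m; apply/asboolP.
case: ex_minnP => m /asboolP mg min; split=> [mn|ng]; first exact: leq_word_ball mg.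
by apply: min; apply/asboolP.
Qed.

Lemma ball_seq (G : groupType) (S : set G) n : finite_generating_set S ->
  exists s : seq G, forall g, (word_length S g <= n)%N <-> g \in s.
Proof.
move=> gS; exists (enum_fset (ball S n)) => g; rewrite word_lengthP //.
by case: gS => fS _; split=> /(ballP n g fS).
Qed.

Lemma quasi_isometry_coarse (R : realType) (G H : groupType) (S : set G) (T : set H)
    (f : G -> H) : finite_generating_set S -> finite_generating_set T ->
  quasi_isometry (word_metric R S) (word_metric R T) f -> coarse_equivalence f.
Proof.
move=> gS gT [C [K [C1 K0 fq fs]]]; have C0 : (0 < C)%R by apply: lt_le_trans C1.
have archi (x : R) : exists n : nat, (x <= n%:R)%R.
  exists (Num.bound `|x|%R); apply: le_trans (ler_norm x) _.
  by apply/ltW/archi_boundP.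
split=> [S'|S'|].
- have [q _ qS] := word_ball_seq S' gS.
  have [r Hr] := archi (C * q%:R + K)%R; have [s sP] := ball_seq r gT.
  exists s => g t /qS/(word_lengthP _ _ gS) tq; apply/sP.
  rewrite -(ler_nat R); apply: le_trans Hr.
  have /andP[_] := fq g (g * t); rewrite /word_metric mulKg => /le_trans; apply.
  by rewrite lerD2r ler_pM2l // ler_nat.
- have [q _ qS] := word_ball_seq S' gT.
  have [r Hr] := archi (C * (q%:R + K))%R; have [s sP] := ball_seq r gS.
  exists s => g g' /qS/(word_lengthP _ _ gT) tq; apply/sP.
  rewrite -(ler_nat R); apply: le_trans Hr; rewrite -ler_pdivrMl //.
  have /andP[h _] := fq g g'; move: h; rewrite lerBlDr => /le_trans; apply.
  by rewrite lerD2r ler_nat.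
- have [r Hr] := archi K; have [s sP] := ball_seq r gT.
  exists s => y; have [x xy] := fs y; exists x; apply/sP.
  by rewrite -(ler_nat R); apply: le_trans Hr.
Qed.

(** * Folner bounds for iterated lampshufflers *)

Section IteratedShuffler.
Variables (R : realType) (A : groupType) (a : nat).
Hypotheses (Ainf : infinite_set [set: A]%classic) (Aa : has_growth_degree A R a).

Lemma growth_degree_gt0 : (0 < a)%N.
Proof.
rewrite lt0n; apply/eqP => a0; apply: Ainf.
have [S [C [gS [C0 SC]]]] := growth_degreeP Aa.
(* Degree 0 would bound every ball by [C], but some ball contains [C.+1] given elements. *)
have [X _ CX] := infinite_set_fset C.+1 Ainf.
have [q q0 qX] := word_ball_seq X gS; have [_] := SC q q0.
rewrite a0 expn0 muln1 leqNgt => /negP[]; apply: leq_trans CX _.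
apply: leq_card_seq => x xX; apply/ballP; [by case: gS | exact: qX].
Qed.

Lemma infinite_neq1 : exists s : A, s != 1.
Proof.
apply: contrapT => h; apply: Ainf; apply: sub_finite_set (finite_set1 1).
by move=> s _; apply: contrapT => /eqP s1; apply: h; exists s.
Qed.

Lemma iter_Shuffler_neq1 n : exists s : iter_Shuffler n A, s != 1.
Proof.
elim: n => [|n [s s1]]; first exact: infinite_neq1.
by exists (mover s); apply: contra s1 => /eqP [->].
Qed.

Lemma iter_Shuffler_lower n : folner_lower (iter_Shuffler n A) a n.
Proof.
elim: n => [|n IH].
  by have [S [C [gS SC]]] := growth_degreeP Aa; apply: growth_folner_lower gS SC.
by apply: folner_lower_Shuffler IH; apply: iter_Shuffler_neq1.
Qed.

Lemma iter_Shuffler_upper n : folner_upper (iter_Shuffler n A) a n.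
Proof.
have [S [C [gS SC]]] := growth_degreeP Aa.
(* The passage from height 0 to height 1 creates the logarithm and is separate; later ones absorb
   it. *)
case: n => [|n]; first exact: growth_folner_upper0 gS SC.
elim: n => [|n IH]; first exact: growth_folner_upper1 gS SC.
exact: folner_upper_Shuffler IH.
Qed.

End IteratedShuffler.

Lemma quasi_isometric_iter_Shuffler (R : realType) (n m : nat) (A B : groupType) (a b : nat) :
  infinite_set [set: A]%classic -> infinite_set [set: B]%classic ->
  has_growth_degree A R a -> has_growth_degree B R b ->
  quasi_isometric R (iter_Shuffler n A) (iter_Shuffler m B) -> n = m /\ a = b.
Proof.
move=> Ai Bi Aa Bb [S [T [gS gT [f /(quasi_isometry_coarse gS gT) fc]]]].
have [f' f'c] := coarse_equivalence_sym fc.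
have upA := folner_upper_coarse fc (iter_Shuffler_upper (n := m) Bb).
have upB := folner_upper_coarse f'c (iter_Shuffler_upper (n := n) Aa).
(* Each direction compares the pairs (height, degree) lexicographically; both together force
   equality. *)
have := folner_exponents (growth_degree_gt0 Ai Aa) (iter_Shuffler_lower Ai Aa n) upA.
have := folner_exponents (growth_degree_gt0 Bi Bb) (iter_Shuffler_lower Bi Bb m) upB.
lia.
Qed.

(** * Bornologous bijections *)

Definition coarsely_bijective (G H : groupType) : Prop :=
  exists (f : G -> H) (f' : H -> G),
    [/\ cancel f f', cancel f' f, bornologous f & bornologous f'].

Section ShufflerMap.
Variables (G H : groupType) (f : G -> H) (f' : H -> G).
Hypotheses (fK : cancel f f') (f'K : cancel f' f).

Lemma fsym_conj_bij (s : FSym G) : bijective (fun y => f (s (f' y))).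
Proof.
exists (fun y => f (fsym_invfun s (f' y))) => y.
  by rewrite fK fsym_invfunK f'K.
by rewrite fK fsym_invfunVK f'K.
Qed.

Lemma fsym_conj_fin (s : FSym G) : finite_set [set y | f (s (f' y)) <> y]%classic.
Proof.
apply: sub_finite_set (finite_image f (fsym_fin s)) => y /= ny.
by exists (f' y); rewrite ?f'K // => e; apply: ny; rewrite e f'K.
Qed.

Definition fsym_conj s : FSym H := MkFSym (fsym_conj_bij s) (fsym_conj_fin s).

Definition shuffler_map (t : Shuffler G) : Shuffler H :=
  Shuffle (fsym_conj (shuf_perm t)) (f (shuf_pos t)).

(* The permutation part of [(f_* t)^-1 * f_* (t * u)] is supported in the
   increments of [f] along the support of [u]. *)
Lemma shuffler_map_bornologous : bornologous f -> bornologous shuffler_map.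
Proof.
move=> fb S.
have /boolp.choice[supp suppP] (u : Shuffler G) := fsym_support_seq (shuf_perm u).
have [X XP] := fb (flatten [seq supp u | u <- S]).
have [P PP] := fb [seq shuf_pos u | u <- S].
have [Q [QP _]] := fsym_supported [fset x in X].
pose mk g p : Shuffler H := Shuffle g p.
exists [seq mk g p | g <- enum_fset Q, p <- P] => -[s p] [t h] uS.
rewrite mul_shuffleE /shuffler_map /=.
set g := Shuffle _ _; set g' := Shuffle _ _.
have -> : (g : Shuffler H)^-1 * g' = mk (fsym_act (f p)^-1
    ((fsym_conj s)^-1 * fsym_conj (s * fsym_act p t))) ((f p)^-1 * f (p * h)).
  by rewrite fsym_actM.
apply: (allpairs_f mk); last exact/PP/(map_f (@shuf_pos G) uS).
apply/QP => y yX.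
have E : fsym_conj (s * fsym_act p t) = fsym_conj s * fsym_conj (fsym_act p t).
  by apply: fsymP => z /=; rewrite fK.
rewrite E mulKg; change ((f p)^-1 * f (p * t (p^-1 * f' ((f p)^-1^-1 * y))) = y).
rewrite invgK (suppP (Shuffle t h)) ?mulVKg ?f'K ?mulKg //.
apply: contra yX => yt; rewrite in_fset /=.
have -> : y = (f p)^-1 * f (p * (p^-1 * f' (f p * y))) by rewrite mulVKg f'K mulKg.
by apply: XP; apply/flattenP; exists (supp (Shuffle t h)) => //; apply: map_f.
Qed.

End ShufflerMap.

Lemma coarsely_bijective_Shuffler (G H : groupType) :
  coarsely_bijective G H -> coarsely_bijective (Shuffler G) (Shuffler H).
Proof.
move=> [f [f' [fK f'K fb f'b]]].
exists (shuffler_map fK f'K), (shuffler_map f'K fK); split.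
- move=> [s p]; rewrite /shuffler_map /= fK; congr Shuffle.
  by apply: fsymP => x /=; rewrite !fK.
- move=> [s p]; rewrite /shuffler_map /= f'K; congr Shuffle.
  by apply: fsymP => x /=; rewrite !f'K.
- exact: shuffler_map_bornologous.
- exact: shuffler_map_bornologous.
Qed.

(** * Finite generation of lampshufflers *)

Section ShufflerGeneration.
Variables (H : groupType) (S : set H).
Hypothesis gS : finite_generating_set S.

Let S' : set (Shuffler H) :=
  ((@mover H @` S) `|` ((fun s => switch 1 s) @` S))%classic.

Let gen (t : Shuffler H) := exists n, word_ball S' n t.

Let gen1 : gen 1. Proof. by exists 0%N; apply: word_ball1. Qed.

Let genM t u : gen t -> gen u -> gen (t * u).
Proof. by move=> [m tm] [n un]; exists (m + n)%N; apply: word_ballM. Qed.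

Let genV t : gen t -> gen t^-1.
Proof. by move=> [n tn]; exists n; apply: word_ballV. Qed.

Let gen_mover (h : H) : gen (mover h).
Proof.
have [_ /(_ h)[n]] := gS; elim: n h => [|n IH] h.
  move=> [[|? ?] [w0 _ ->]] //; rewrite big_nil; exact: gen1.
case/word_ballS => [->|[s [k [sS /IH gk ->]]]]; first exact: gen1.
have -> : mover (s * k) = mover s * mover k by rewrite mul_mover.
apply: genM gk; case: sS => sS.
  by exists 1%N; apply: word_ball_gen; left; left; exists s.
have -> : mover s = (mover s^-1)^-1.
  by apply: (mulgI (mover s^-1)); rewrite mulgV mul_mover /= mulVg.
by apply: genV; exists 1%N; apply: word_ball_gen; left; left; exists s^-1.
Qed.

Let inPerm (s : FSym H) : Shuffler H := Shuffle s 1.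

Let inPermM s t : inPerm (s * t) = inPerm s * inPerm t.
Proof. by rewrite mul_shuffleE fsym_act1 mul1g. Qed.

Let switch_conj (x y p : H) : switch (p * x) (p * y) = mover p * switch x y * (mover p)^-1.
Proof.
apply: (mulIg (mover p)); rewrite mulgVK mul_mover mul_shuffleE /= mul1g.
by rewrite fsym_act_swap mul1g mulg1.
Qed.

(** Conjugation by movers yields the transpositions along single generators; [fswap_trans] composes
    them along a word from [x] to [y]. *)
Let gen_switch (x y : H) : gen (switch x y).
Proof.
have [_ /(_ (x^-1 * y))[n]] := gS; rewrite -{2}(mulVKg x y).
move: (x^-1 * y) => h {y}; elim: n h x => [|n IH] h x.
  move=> [[|? ?] [w0 _ ->]] //; rewrite big_nil mulg1 /switch fswapxx; exact: gen1.
case/word_ballS => [->|[s [k [sS kn ->]]]].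
  by rewrite mulg1 /switch fswapxx; exact: gen1.
have g1 : gen (switch x (x * s)).
  have -> : switch x (x * s) = mover x * switch 1 s * (mover x)^-1.
    by rewrite -switch_conj mulg1.
  apply: genM; last exact/genV/gen_mover.
  apply: genM; first exact: gen_mover.
  case: sS => sS; first by exists 1%N; apply: word_ball_gen; left; right; exists s.
  have -> : switch 1 s = mover s * switch 1 s^-1 * (mover s)^-1.
    by rewrite -switch_conj mulg1 mulgV /switch fswapC.
  apply: genM; last exact/genV/gen_mover.
  apply: genM; first exact: gen_mover.
  by exists 1%N; apply: word_ball_gen; left; right; exists s^-1.
have g2 := IH k (x * s) kn; rewrite mulgA; set y := x * s; set z := y * k.
have [->|/eqP xz] := eqVneq x z; first by rewrite /switch fswapxx; exact: gen1.
have [<-|/eqP yz] := eqVneq y z; first exact: g1.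
have -> : switch x z = switch x y * switch y z * switch x y.
  by rewrite -!inPermM fswap_trans.
exact: genM (genM g1 g2) g1.
Qed.

(** Composing [s] with the transposition of [x] and [s x] fixes [x], so the support shrinks. *)
Let gen_perm (s : FSym H) : gen (inPerm s).
Proof.
have [X hX] := proj1 finite_fsetP (fsym_fin s).
have : forall x, x \notin X -> s x = x.
  move=> x xX; apply: contrapT => nx; move/negP: xX; apply.
  by change ([set` X]%classic x); rewrite -hX.
clear hX; have [n] := ubnPleq #|` X|; elim: n X s => [|n IH] X s Xn sX.
  have -> : s = 1; last exact: gen1.
  apply: fsymP => x; rewrite sX //.
  by move: Xn; rewrite leqn0 cardfs_eq0 => /eqP ->; rewrite in_fset0.
have [X0|/fset0Pn[x xX]] := eqVneq X fset0.
  by apply: (IH X) => //; rewrite X0 cardfs0.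
have -> : s = fswap x (s x) * (fswap x (s x) * s) by rewrite mulgA fswapK mul1g.
rewrite inPermM; apply: genM; first exact: gen_switch.
apply: (IH (X `\ x)).
  by move: Xn; rewrite (cardfsD1 x) xX.
move=> y; rewrite in_fsetD1 negb_and negbK.
change (((y == x) || (y \notin X)) -> fswap x (s x) (s y) = y).
have [->|yx] := eqVneq y x; first by rewrite fswapR.
move=> yX; rewrite (sX _ yX) fswapD //; first exact/eqP.
by move=> e; move/eqP: yx; apply; apply: (bij_inj (fsym_bij s)); rewrite -e sX.
Qed.

Lemma Shuffler_generating : finite_generating_set S'.
Proof.
split.
  by rewrite finite_setU; split; apply: finite_image; case: gS.
move=> [s h]; have -> : (Shuffle s h : Shuffler H) = inPerm s * mover h.
  by rewrite mul_mover /= mul1g.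
exact: genM (gen_perm s) (gen_mover h).
Qed.

End ShufflerGeneration.

Lemma finitely_generated_Shuffler (H : groupType) :
  finitely_generated H -> finitely_generated (Shuffler H).
Proof. by move=> [S gS]; eexists; apply: Shuffler_generating gS. Qed.

(** [c] bounds the increments of [f] along single generators, and these add up along a word. *)
Lemma bornologous_lipschitz (G H : groupType) (S : set G) (T : set H) (f : G -> H) :
  finite_generating_set S -> finite_generating_set T -> bornologous f ->
  exists2 c, (0 < c)%N & forall g g',
    (word_length T ((f g)^-1 * f g') <= c * word_length S (g^-1 * g'))%N.
Proof.
move=> gS gT fb; have [s0 s0P] := symmetric_seq (proj1 gS); have [T' T'P] := fb s0.
have [c c0 cP] := word_ball_seq T' gT; exists c => // g g'.
apply/(word_lengthP _ _ gT); rewrite -[in f g'](mulVKg g g').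
have := proj1 (word_lengthP (g^-1 * g') _ gS) (leqnn _).
move: (g^-1 * g') => h {g'}; move: (word_length S h) => n.
elim: n h g => [|n IH] h g.
  by move=> [[|? ?] [w0 _ ->]] //; rewrite big_nil mulg1 mulVg; apply: word_ball1.
case/word_ballS => [->|[s [k [/s0P sS kn ->]]]].
  by rewrite mulg1 mulVg; apply: word_ball1.
have -> : (f g)^-1 * f (g * (s * k)) =
    ((f g)^-1 * f (g * s)) * ((f (g * s))^-1 * f (g * s * k)).
  by rewrite -!mulgA mulVKg.
by rewrite mulnS; apply: word_ballM (IH k (g * s) kn); apply/cP/T'P.
Qed.

Lemma coarsely_bijective_biLipschitz (R : realType) (G H : groupType) :
  finitely_generated G -> finitely_generated H ->
  coarsely_bijective G H -> biLipschitz_equivalent R G H.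
Proof.
move=> [S gS] [T gT] [f [f' [fK f'K fb f'b]]]; exists S, T; split=> //.
have [c c0 cP] := bornologous_lipschitz gS gT fb.
have [c' c'0 c'P] := bornologous_lipschitz gT gS f'b.
exists f; first by exists f'.
exists (c + c')%:R%R, 0%R; split=> //; first by rewrite ler1n addn_gt0 c0.
  move=> g g'; rewrite subr0 addr0 /word_metric -natrM.
  rewrite ler_pdivrMl ?ltr0n ?addn_gt0 ?c0 // -natrM !ler_nat; apply/andP; split.
    have := c'P (f g) (f g'); rewrite !fK => /leq_trans; apply.
    by rewrite leq_mul2r leq_addl orbT.
  by apply: leq_trans (cP _ _) _; rewrite leq_mul2r leq_addr orbT.
move=> y; exists (f' y); rewrite f'K /word_metric mulVg lern0.
by rewrite -leqn0; apply/(word_lengthP _ _ gT); apply: word_ball1.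
Qed.

(** * Virtually abelian groups *)

Section LatticeHom.
Variable A : groupType.

Definition zpow (y : A) (n : int) : A :=
  match n with Posz m => y ^+ m | Negz m => y ^- m.+1 end.

Lemma zpow_sub (y : A) (m n : nat) : zpow y (m%:Z - n%:Z)%R = y ^+ m * y ^- n.
Proof.
have [le|/ltnW le] := leqP n m.
  by rewrite subzn //= expgnFr.
have -> : (m%:Z - n%:Z = - (n - m)%N%:Z)%R by lia.
rewrite -[in RHS](subnK le) expgnDr invgM mulVKg.
by case: (n - m)%N => [|k]; rewrite ?oppr0 -?NegzE //= invg1.
Qed.

Lemma zpowD (y : A) (m n : int) : zpow y (m + n)%R = zpow y m * zpow y n.
Proof.
have E (k : int) : exists p q : nat, k = (p%:Z - q%:Z)%R.
  case: k => k; [exists k, 0%N | exists 0%N, k.+1]; lia.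
have [p [q ->]] := E m; have [p' [q' ->]] := E n.
have -> : (p%:Z - q%:Z + (p'%:Z - q'%:Z) = (p + p')%N%:Z - (q + q')%N%:Z)%R by lia.
have c : commute (y ^- q) (y ^+ p') by apply/commute_sym/commuteV/commuteX2.
rewrite !zpow_sub [(q + q')%N]addnC !expgnDr invgM -!mulgA; congr (_ * _).
by rewrite !mulgA c.
Qed.

Definition lattice_hom d (psi : 'rV[int]_d -> A) : Prop :=
  forall u v, psi (u + v)%R = psi u * psi v.

Lemma lattice_hom0 d (psi : 'rV[int]_d -> A) : lattice_hom psi -> psi 0%R = 1.
Proof. by move=> h; apply: (mulgI (psi 0%R)); rewrite -h addr0 mulg1. Qed.

Lemma lattice_homN d (psi : 'rV[int]_d -> A) u : lattice_hom psi ->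
  psi (- u)%R = (psi u)^-1.
Proof.
by move=> h; apply: (mulgI (psi u)); rewrite -h subrr mulgV lattice_hom0.
Qed.

Lemma lattice_hom_ker d (psi : 'rV[int]_d -> A) u (n : int) : lattice_hom psi ->
  psi u = 1 -> psi (u *~ n)%R = 1.
Proof.
move=> h u1; have pos (m : nat) : psi (u *+ m)%R = 1.
  by elim: m => [|m IH]; rewrite ?mulr0n ?lattice_hom0 // mulrS h u1 IH mulg1.
by case: n => n; rewrite ?NegzE ?mulrNz ?lattice_homN // -pmulrn pos ?invg1.
Qed.

(** Each element of [Y] gets one coordinate, acting by its powers; commutativity of [K] makes the
    product a homomorphism. *)
Lemma lattice_hom_seq (K : {pred A}) (Y : seq A) : group_closed K ->
  {in K &, forall x y, commute x y} -> {subset Y <= K} ->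
  exists d (psi : 'rV[int]_d -> A), [/\ lattice_hom psi, forall v, psi v \in K
    & forall y, y \in Y -> exists v, psi v = y].
Proof.
move=> Kg Kc; have [K1 KF] := Kg.
have KM := group_closedM Kg; have KV := group_closedV Kg.
have KX y (n : int) : y \in K -> zpow y n \in K.
  move=> yK; have h m : y ^+ m \in K.
    by elim: m => [|m IH]; rewrite ?expg0 // expgS KM.
  by case: n => n /=; [|apply: KV]; apply: h.
elim: Y => [|y Y IH] YK.
  by exists 0%N, (fun=> 1); split=> // u v; rewrite mulg1.
have [|d [psi [hpsi psiK psiY]]] := IH; first by move=> z zY; apply: YK; rewrite in_cons zY orbT.
have yK : y \in K by apply/YK/mem_head.
exists (1 + d)%N, (fun v => zpow y (lsubmx v 0%R 0%R) * psi (rsubmx v)); split.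
- move=> u v; rewrite !raddfD /= mxE zpowD hpsi -!mulgA; congr (_ * _); rewrite !mulgA.
  by congr (_ * _); apply: Kc => //; apply: KX.
- by move=> v; apply: KM => //; apply: KX.
- move=> z; rewrite in_cons => /orP[/eqP ->|/psiY[v <-]].
    exists (row_mx (const_mx 1%R : 'rV_1) (0%R : 'rV_d)).
    rewrite row_mxKl row_mxKr mxE /= lattice_hom0 //.
    by rewrite mulg1.
  by exists (row_mx (0%R : 'rV_1) v); rewrite row_mxKl row_mxKr mxE /= mul1g.
Qed.

Definition lattice_cover d (psi : 'rV[int]_d -> A) (L : seq A) : Prop :=
  forall g, exists v c, c \in L /\ g = psi v * c.

(** If [psi] kills [c] with [i]-th coordinate nonzero, multiples of [c] reduce the [i]-th coordinate
    to finitely many remainders. These are moved into [L], and the dimension drops by one. *)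
Lemma lattice_injective d (psi : 'rV[int]_d -> A) (L : seq A) :
  lattice_hom psi -> lattice_cover psi L ->
  exists d' (psi' : 'rV[int]_d' -> A) L',
    [/\ lattice_hom psi', injective psi' & lattice_cover psi' L'].
Proof.
elim: d psi L => [|d IH] psi L hpsi cpsi.
  by exists 0%N, psi, L; split=> // u v _; rewrite [u]thinmx0 [v]thinmx0.
have [inj|ninj] := pselect (injective psi); first by exists d.+1, psi, L.
have [c [c0 c1]] : exists c, c <> 0%R /\ psi c = 1.
  apply: contrapT => h; apply: ninj => u v uv; apply/eqP; rewrite -subr_eq0; apply/eqP.
  apply: contrapT => uv0; apply: h; exists (u - v)%R; split=> //.
  by rewrite hpsi lattice_homN // uv mulgV.
have [i ci] : exists i, c 0%R i != 0%R.
  apply: contrapT => h; apply: c0; apply/rowP => i; rewrite mxE.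
  by apply: contrapT => /eqP ci; apply: h; exists i.
pose ins (w : 'rV[int]_d) : 'rV[int]_d.+1 :=
  (\row_j if unlift i j is Some j' then w 0 j' else 0)%R.
pose e (t : int) : 'rV[int]_d.+1 := (\row_j if j == i then t else 0)%R.
pose n := `|c 0%R i|%N.
apply: (IH (psi \o ins) [seq psi (e (Posz t)) * b | t <- iota 0 n, b <- L]).
  move=> u v /=; rewrite -hpsi; congr psi; apply/rowP => j; rewrite !mxE.
  by case: unlift => [j'|]; rewrite ?mxE ?addr0.
move=> g; have [v [b [bL ->]]] := cpsi g.
pose q := (v 0%R i %/ c 0%R i)%Z; pose t := `|(v 0%R i %% c 0%R i)%Z|%N.
have tE : Posz t = (v 0%R i %% c 0%R i)%Z by rewrite gez0_abs // modz_ge0.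
exists (\row_j (v - q *: c)%R 0%R (lift i j))%R, (psi (e (Posz t)) * b); split.
  apply: (allpairs_f (fun (t : nat) b => psi (e (Posz t)) * b)) => //.
  rewrite mem_iota /= add0n -ltz_nat tE /n abszE; exact: ltz_mod.
rewrite mulgA /= -hpsi; congr (_ * _).
have -> : psi v = psi (v - q *: c)%R.
  by rewrite hpsi lattice_homN // -[q]intz scaler_int lattice_hom_ker // invg1 mulg1.
congr psi; apply/rowP => j; rewrite !mxE; case: unliftP => [j' ->|->].
  by rewrite !mxE eq_sym (negbTE (neq_lift _ _)) addr0.
by rewrite eqxx add0r tE {1}(divz_eq (v 0%R i) (c 0%R i)) addrAC subrr add0r.
Qed.

(** While two distinct elements of [L] represent the same coset of the image of [psi], one of them
    is discarded. *)
Lemma lattice_transversal d (psi : 'rV[int]_d -> A) (L : seq A) :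
  lattice_hom psi -> lattice_cover psi L ->
  exists L', [/\ lattice_cover psi L', uniq L' &
    forall u v c c', c \in L' -> c' \in L' -> psi u * c = psi v * c' -> c = c'].
Proof.
move=> hpsi; have [n] := ubnP (size L); elim: n L => // n IH L Ln cL.
have [bad|good] := pselect (exists u v c c',
    [/\ c \in L, c' \in L, c <> c' & psi u * c = psi v * c']); last first.
  exists (undup L); split; rewrite ?undup_uniq //.
    by move=> g; have [v [c [cL' ->]]] := cL g; exists v, c; rewrite mem_undup.
  move=> u v c c'; rewrite !mem_undup => cL1 cL2 e; apply: contrapT => ne.
  by apply: good; exists u, v, c, c'.
have [u [v [c [c' [cL1 cL2 ne e]]]]] := bad.
apply: (IH [seq x <- L | x != c']).
  have : (0 < count (predC (fun x => x != c')) L)%N.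
    by rewrite -has_count; apply/hasP; exists c'; rewrite //= negbK.
  move=> p0; rewrite size_filter; rewrite ltnS in Ln; apply: leq_trans Ln.
  by rewrite -(count_predC (fun x => x != c') L) -[X in (X < _)%N]addn0 ltn_add2l.
move=> g; have [w [b [bL ->]]] := cL g.
have [bc|bc] := eqVneq b c'; last by exists w, b; rewrite mem_filter bc.
exists (w - v + u)%R, c; rewrite mem_filter cL1 andbT; split; first exact/eqP.
by rewrite !hpsi lattice_homN // -mulgA e mulgA mulgVK bc.
Qed.

End LatticeHom.

(** The Schreier elements [c'^-1 * (s * c)] lying in [K] are finitely many, so some [psi] reaches
    them all. Pushing coset representatives through a word letter by letter writes every element as
    [c * psi v]. *)
Lemma virtually_abelian_cover (A : groupType) :
  finitely_generated A -> virtually_abelian A ->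
  exists d (psi : 'rV[int]_d -> A) L, lattice_hom psi /\ lattice_cover psi L.
Proof.
move=> [S gS] [K [Kg Kc finK]]; have [K1 _] := Kg.
have [R RP] : exists R : seq A, forall g, exists2 c, c \in R & c^-1 * g \in K.
  have /boolp.choice[r rP] : forall X : set A, exists x, (exists y, X y) -> X x.
    by move=> X; have [[x Xx]|nX] := pselect (exists y, X y); [exists x | exists 1].
  have [R hR] := proj1 (finite_seqP _) (finite_image r finK).
  exists R => g; pose X := [set g * k | k in [set` K]]%classic.
  exists (r X).
    by change ([set` R]%classic (r X)); rewrite -hR; exists X => //; exists g.
  have [|k kK <-] := rP X; first by exists g; exists 1; rewrite ?mulg1.
  by rewrite invgM mulgVK; apply: group_closedV.
have [s0 s0P] := symmetric_seq (proj1 gS).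
pose Y0 := [seq c'^-1 * t | c' <- R,
  t <- [seq s * c | s <- s0, c <- 1 :: R]].
have [|d [psi [hpsi _ psiY]]] := @lattice_hom_seq _ K [seq y <- Y0 | y \in K] Kg Kc.
  by move=> y; rewrite mem_filter => /andP[].
have cov g : exists v c, c \in 1 :: R /\ g = c * psi v.
  have [_ /(_ g)[n]] := gS; elim: n g => [|n IH] g.
    move=> [[|? ?] [w0 _ ->]] //; rewrite big_nil; exists 0%R, 1.
    by rewrite mem_head lattice_hom0 // mulg1.
  case/word_ballS => [->|[s [h [/s0P sS /IH[v [c [cR ->]]] ->]]]].
    by exists 0%R, 1; rewrite mem_head lattice_hom0 // mulg1.
  have [c' c'R c'K] := RP (s * c); have [|w wE] := psiY (c'^-1 * (s * c)).
    rewrite mem_filter c'K /=; apply: (allpairs_f (fun c' t => c'^-1 * t)) => //.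
    exact: allpairs_f.
  exists (w + v)%R, c'; split; first by rewrite in_cons c'R orbT.
  by rewrite hpsi wE !mulgA mulgV mul1g.
(* Inversion moves the representatives to the right, as [lattice_cover] demands. *)
exists d, psi, [seq c^-1 | c <- 1 :: R]; split=> // g.
have [v [c [cR e]]] := cov g^-1; exists (- v)%R, c^-1; split; first exact: map_f.
by rewrite lattice_homN // -invgM -e invgK.
Qed.

(** A bijection with Z^d that is bornologous both ways, with increments on the lattice side written
    additively. *)
Definition lattice_chart (A : groupType) d : Prop :=
  exists (F : 'rV[int]_d -> A) F',
    [/\ cancel F F', cancel F' F,
        forall D : seq 'rV[int]_d, exists S : seq A,
          forall u x, x \in D -> (F u)^-1 * F (u + x)%R \in S
      & forall S : seq A, exists D : seq 'rV[int]_d,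
          forall g s, s \in S -> (F' (g * s)%g - F' g)%R \in D].

Lemma lattice_charts_bijective (A B : groupType) d :
  lattice_chart A d -> lattice_chart B d -> coarsely_bijective A B.
Proof.
move=> [F [F' [FK F'K FS F'D]]] [E [E' [EK E'K ES E'D]]].
exists (E \o F'), (F \o E'); split.
- by move=> g /=; rewrite EK F'K.
- by move=> g /=; rewrite FK E'K.
- move=> S; have [D DP] := F'D S; have [S' S'P] := ES D; exists S' => g s /DP h.
  by have := S'P (F' g) _ (h g); rewrite addrC subrK.
- move=> S; have [D DP] := E'D S; have [S' S'P] := FS D; exists S' => g s /DP h.
  by have := S'P (E' g) _ (h g); rewrite addrC subrK.
Qed.

(** * A chart by Euclidean division in the first coordinate *)

Section Chart.
Variables (A : groupType) (d : nat) (psi : 'rV[int]_d.+1 -> A) (L : seq A).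
Hypotheses (hpsi : lattice_hom psi) (psi_inj : injective psi).
Hypotheses (Lcov : lattice_cover psi L) (Lu : uniq L).
Hypothesis Ltr : forall u v c c',
  c \in L -> c' \in L -> psi u * c = psi v * c' -> c = c'.

Let k : int := Posz (size L).

Let k_gt0 : (0 < k)%R.
Proof. by have [_ [c [cL _]]] := Lcov 1; rewrite /k; case: (L) cL. Qed.

Let k0 : k != 0%R. Proof. exact: lt0r_neq0. Qed.

Let quo (u : 'rV[int]_d.+1) : 'rV[int]_d.+1 :=
  (\row_j if j == 0 then (u 0%R 0%R %/ k)%Z else u 0 j)%R.

Let res (u : 'rV[int]_d.+1) : nat := `|(u 0%R 0%R %% k)%Z|%N.

(** [t] is an integer rather than a remainder, so that [join] also applies to differences of
    remainders. *)
Let join (w : 'rV[int]_d.+1) (t : int) : 'rV[int]_d.+1 :=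
  (\row_j if j == 0 then w 0 0 * k + t else w 0 j)%R.

Let resE u : Posz (res u) = (u 0%R 0%R %% k)%Z.
Proof. by rewrite gez0_abs // modz_ge0. Qed.

Let res_lt u : (res u < size L)%N.
Proof. by rewrite -ltz_nat resE -/k ltz_pmod. Qed.

Let joinK u : join (quo u) (res u) = u.
Proof.
apply/rowP => j; rewrite !mxE eqxx; case: eqP => // ->.
by rewrite resE -divz_eq.
Qed.

Let quo_join w (t : nat) : (t < size L)%N -> quo (join w t) = w.
Proof.
move=> tL; apply/rowP => j; rewrite !mxE eqxx; case: eqP => // ->.
by rewrite divzMDl // divz_small ?addr0 //= ger0_norm ?ltz_nat.
Qed.

Let res_join w (t : nat) : (t < size L)%N -> res (join w t) = t.
Proof.
move=> tL; apply/eqP; rewrite -eqz_nat resE mxE eqxx.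
by rewrite modzMDl modz_small ?eqxx //= ltz_nat.
Qed.

Let F u := psi (quo u) * nth 1 L (res u).

Let Finj : injective F.
Proof.
move=> u v uv; have e := Ltr (mem_nth 1 (res_lt u)) (mem_nth 1 (res_lt v)) uv.
have r : res u = res v by apply/eqP; rewrite -(nth_uniq 1 _ _ Lu) ?e.
move: uv; rewrite /F r => /(mulIg _)/psi_inj q.
by rewrite -(joinK u) -(joinK v) r q.
Qed.

Lemma transversal_chart : lattice_chart A d.+1.
Proof.
have /boolp.choice[F' F'K] : forall g, exists u, F u = g.
  move=> g; have [v [c [cL ->]]] := Lcov g; exists (join v (index c L)).
  by rewrite /F quo_join ?res_join ?index_mem ?nth_index.
have FK : cancel F F' by move=> u; apply: Finj; rewrite F'K.
have quot u v : (F u)^-1 * F v =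
    (nth 1 L (res u))^-1 * (psi (quo v - quo u)%R * nth 1 L (res v)).
  by rewrite /F invgM addrC hpsi lattice_homN // -!mulgA.
have resI u : res u \in iota 0 (size L) by rewrite mem_iota res_lt.
exists F, F'; split=> // [D|S].
(* The change of quotient from [u] to [u + x] depends only on the remainder of [u] and on [x], hence
   takes finitely many values. *)
- pose carry (r : nat) (x : 'rV[int]_d.+1) : 'rV[int]_d.+1 :=
    (\row_j if j == 0 then ((Posz r + x 0%R 0%R)%R %/ k)%Z else x 0 j)%R.
  exists [seq c^-1 * t | c <- L, t <- [seq psi w * c |
    w <- [seq carry r x | r <- iota 0 (size L), x <- D], c <- L]] => u x xD.
  rewrite quot; apply: (allpairs_f (fun c t => c^-1 * t)); first exact: mem_nth.
  apply: (allpairs_f (fun w c => psi w * c)); last exact: mem_nth.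
  have -> : (quo (u + x) - quo u = carry (res u) x)%R.
    apply/rowP => j; rewrite !mxE; case: eqP => _; last by rewrite addrAC subrr add0r.
    rewrite {1}(divz_eq (u 0%R 0%R) k) -addrA divzMDl // resE.
    by rewrite addrAC subrr add0r.
  exact: allpairs_f.
(* [phi] is a left inverse of [psi], with junk values outside its image. *)
- have /boolp.choice[phi phiP] : forall g, exists v, (exists w, psi w = g) -> psi v = g.
    by move=> g; have [[w e]|n] := pselect (exists w, psi w = g); [exists w | exists 0%R].
  have psiK w : phi (psi w) = w by apply/psi_inj/phiP; exists w.
  exists [seq join w z | w <- [seq phi g | g <- [seq c * t | c <- L,
      t <- [seq s * c^-1 | s <- S, c <- L]]],
    z <- [seq (Posz r' - Posz r)%R | r' <- iota 0 (size L), r <- iota 0 (size L)]] => g s sS.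
  set u := F' g; set v := F' _.
  have sE : s = (nth 1 L (res u))^-1 * (psi (quo v - quo u)%R * nth 1 L (res v)).
    by rewrite -quot !F'K mulKg.
  have -> : (v - u)%R = join (quo v - quo u)%R (Posz (res v) - Posz (res u))%R.
    rewrite -{1}(joinK v) -{1}(joinK u); apply/rowP => j; rewrite !mxE eqxx.
    case: eqP => // _; rewrite mulrBl; lia.
  apply: allpairs_f; last exact: (allpairs_f (fun r' r => (Posz r' - Posz r)%R)).
  rewrite -[(quo v - quo u)%R]psiK; apply: map_f.
  have -> : psi (quo v - quo u)%R = nth 1 L (res u) * (s * (nth 1 L (res v))^-1).
    by rewrite sE -mulgA mulgK mulVKg.
  apply: allpairs_f; first exact: mem_nth.
  by apply: (allpairs_f (fun s c => s * c^-1)); last exact: mem_nth.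
Qed.

End Chart.

Lemma virtually_abelian_chart (A : groupType) : infinite_set [set: A]%classic ->
  finitely_generated A -> virtually_abelian A -> exists d, lattice_chart A d.
Proof.
move=> Ainf Afg Ava; have [d0 [psi0 [L0 [h0 c0]]]] := virtually_abelian_cover Afg Ava.
have [[|d] [psi [L [hpsi psi_inj cL]]]] := lattice_injective h0 c0.
  (* In dimension 0 the group would be contained in the finite list [L]. *)
  exfalso; apply: Ainf; apply: sub_finite_set (finite_seq L) => g _ /=.
  have [v [c [cL' ->]]] := cL g.
  by rewrite [v]thinmx0 lattice_hom0 // mul1g.
have [L' [cL' uL' tL']] := lattice_transversal hpsi cL.
by exists d.+1; apply: transversal_chart cL' uL' tL'.
Qed.

(** * The dimension of a chart is the growth degree *)

Lemma leq_growth_exponent C p q :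
  (forall n, (0 < n)%N -> (n ^ p <= C * n ^ q)%N) -> (p <= q)%N.
Proof.
move=> h; rewrite leqNgt; apply/negP => qp; have := h C.+1 isT.
rewrite leqNgt => /negP; apply; apply: (@leq_trans (C.+1 ^ q.+1)%N).
  by rewrite expnS ltn_pmul2r // expn_gt0.
by rewrite leq_pexp2l.
Qed.

Section ChartDimension.
Variables (A : groupType) (S : set A) (a C d : nat).
Hypotheses (gS : finite_generating_set S) (SC : growth_bounds S a C).
Hypothesis Ad : lattice_chart A d.

(** A word of length [n] changes each coordinate by at most [m * n], so the ball of radius [n] fits
    in a box of side [2 * (m * n) + 1]. *)
Lemma leq_growth_dimension : (a <= d)%N.
Proof.
have [F [F' [FK F'K _ F'D]]] := Ad; have [s0 s0P] := symmetric_seq (proj1 gS).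
have [D DP] := F'D s0.
have [m mP] : exists m, forall x, x \in D -> forall j, (`|x 0%R j| <= m)%N.
  elim: (D) => [|x D' [m IH]]; first by exists 0%N.
  exists (\sum_j `|x 0%R j| + m)%N => y; rewrite in_cons => /orP[/eqP ->|/IH h] j.
    by rewrite (bigD1 j) //= -!addnA leq_addr.
  by apply: leq_trans (h j) _; apply: leq_addl.
have dist n g h : word_ball S n h ->
    forall j, (`|(F' (g * h)%g - F' g)%R 0%R j| <= m * n)%N.
  elim: n g h => [|n IH] g h.
    by move=> [[|? ?] [w0 _ ->]] // j; rewrite big_nil mulg1 subrr mxE.
  case/word_ballS => [->|[s [k [/s0P sS kn ->]]]] j; first by rewrite mulg1 subrr mxE.
  have := mP _ (DP g s sS) j; have := IH (g * s) k kn j; rewrite !mxE mulgA mulnS; 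
  move: (F' (g * s * k) 0%R j) (F' (g * s) 0%R j) (F' g 0%R j) (m * n)%N => x y z t; lia.
pose pt r (t : {ffun 'I_d -> 'I_(2 * r).+1}) : 'rV[int]_d :=
  (\row_j (Posz (t j) - Posz r))%R.
pose box r := [seq pt r t | t <- enum {ffun 'I_d -> 'I_(2 * r).+1}].
have boxP r (v : 'rV[int]_d) : (forall j, (`|v 0%R j| <= r)%N) -> v \in box r.
  move=> vr; apply/mapP; exists [ffun j => inord `|(v 0%R j + Posz r)%R|%N].
    by rewrite mem_enum.
  apply/rowP => j; rewrite !mxE ffunE inordK; move: (v 0%R j) (vr j) => x; lia.
have [C0 bC] := SC; apply: (@leq_growth_exponent (C * (2 * m + 1) ^ d)) => n n0.
have [lo _] := bC n n0; apply: leq_trans lo _; rewrite -mulnA leq_mul2l -expnMn.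
pose pts := [seq F (F' 1%g + x)%R | x <- box (m * n)%N].
apply/orP; right; apply: (@leq_trans (size pts)).
  apply: leq_card_seq => g /(ballP _ _ (proj1 gS)) gn.
  have -> : g = F (F' 1%g + (F' g - F' 1%g))%R by rewrite addrC subrK F'K.
  apply: (map_f (fun x => F (F' 1%g + x)%R)); apply: boxP => j.
  by have := dist n 1 g gn j; rewrite mul1g.
rewrite size_map size_map -cardT card_ffun !card_ord; apply: leq_expl; nia.
Qed.

(** Conversely, the [n ^ d] points of a cube are reached by unit steps from the origin, hence lie,
    after translation, in a ball of radius linear in [n]. *)
Lemma geq_growth_dimension : (d <= a)%N.
Proof.
have [F [F' [FK F'K FS _]]] := Ad.
pose e j : 'rV[int]_d := (\row_i (i == j)%:R)%R.
have [S0 S0P] := FS [seq e j | j <- enum 'I_d].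
have [q q0 qP] := word_ball_seq S0 gS.
have dist n (w : 'I_d -> nat) : (\sum_j w j)%N = n ->
    word_ball S (q * n) ((F 0%R)^-1 * F (\row_j Posz (w j))%R).
  elim: n w => [|n IH] w wn.
    have -> : (\row_j Posz (w j))%R = 0%R :> 'rV[int]_d.
      apply/rowP => j; rewrite !mxE; move/eqP: wn; rewrite sum_nat_eq0.
      by move=> /forallP/(_ j)/eqP ->.
    by rewrite mulVg; apply: word_ball1.
  have [j wj] : exists j, (0 < w j)%N.
    apply: contrapT => h; move: wn; rewrite big1 // => j _; apply/eqP.
    by rewrite -leqn0 leqNgt; apply/negP => wj; apply: h; exists j.
  pose w' i := (w i - (i == j))%N.
  have -> : (\row_i Posz (w i) = \row_i Posz (w' i) + e j)%R.
    apply/rowP => i; rewrite !mxE /w'; case: eqP => [->|_]; lia.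
  have w'n : (\sum_i w' i)%N = n.
    have : (\sum_i w i = \sum_i w' i + \sum_i (i == j))%N.
      rewrite -big_split; apply: eq_bigr => i _; rewrite /w' /=.
      by case: eqP => [->|_]; lia.
    have -> : (\sum_i (i == j) = 1)%N.
      by rewrite (bigD1 j) //= eqxx big1 // => i /negbTE ->.
    by rewrite wn; lia.
  have step := qP _ (S0P (\row_i Posz (w' i))%R _ (map_f e (mem_enum 'I_d j))).
  rewrite mulnSr -[F (_ + _)%R](mulVKg (F (\row_i Posz (w' i))%R)) mulgA.
  exact: word_ballM (IH _ w'n) step.
(* The constant has [d.+1] rather than [d] because the growth bounds need a positive radius even
   when [d = 0]. *)
have [C0 bC] := SC; apply: (@leq_growth_exponent (C * (q * d.+1) ^ a)) => n n0.
have [|_ up] := bC (q * d.+1 * n)%N; first by rewrite !muln_gt0 q0.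
rewrite -mulnA -expnMn; apply: leq_trans up.
pose pt (t : {ffun 'I_d -> 'I_n}) := (F 0%R)^-1 * F (\row_j Posz (t j))%R.
have pt_inj : injective pt.
  move=> t t' /mulgI/(can_inj FK) /rowP tt; apply/ffunP => j; apply: val_inj.
  by have := tt j; rewrite !mxE => -[].
have -> : (n ^ d)%N = size [seq pt t | t <- enum {ffun 'I_d -> 'I_n}].
  by rewrite size_map -cardT card_ffun !card_ord.
apply: uniq_leq_size; first by rewrite map_inj_uniq ?enum_uniq.
move=> g /mapP[t _ ->]; apply/(ballP _ _ (proj1 gS)).
apply: leq_word_ball (dist _ _ erefl); rewrite -mulnA leq_mul2l; apply/orP; right.
apply: (@leq_trans (\sum_(j < d) n)%N); first by apply: leq_sum => j _; apply: ltnW.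
by rewrite sum_nat_const card_ord leq_mul2r leqnSn orbT.
Qed.

End ChartDimension.

Lemma lattice_chart_growth (R : realType) (A : groupType) (a : nat) :
  infinite_set [set: A]%classic -> finitely_generated A -> virtually_abelian A ->
  has_growth_degree A R a -> lattice_chart A a.
Proof.
move=> Ainf Afg Ava /growth_degreeP[S [C [gS SC]]].
have [d Ad] := virtually_abelian_chart Ainf Afg Ava.
suff -> : a = d by [].
by apply/eqP; rewrite eqn_leq (leq_growth_dimension gS SC Ad) (geq_growth_dimension gS SC Ad).
Qed.

Theorem theoremH (R : realType) (n m : nat) (A B : groupType) (a b : nat)
  (Ainf : infinite_set [set: A]%classic) (Binf : infinite_set [set: B]%classic)
  (Afg : finitely_generated A) (Bfg : finitely_generated B)
  (Ava : virtually_abelian A) (Bva : virtually_abelian B)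
  (Aa : has_growth_degree A R a) (Bb : has_growth_degree B R b) :
  [<-> quasi_isometric R (iter_Shuffler n A) (iter_Shuffler m B);
       n = m /\ a = b;
       biLipschitz_equivalent R (iter_Shuffler n A) (iter_Shuffler m B)].
Proof.
tfae.
- exact: quasi_isometric_iter_Shuffler.
- move=> [nm ab]; subst m b; apply: coarsely_bijective_biLipschitz.
  + by elim: n => [|k IH] //; apply: finitely_generated_Shuffler.
  + by elim: n => [|k IH] //; apply: finitely_generated_Shuffler.
  (* Functoriality reduces to the base groups, which are both charted by the lattice Z^a. *)
  + elim: n => [|k IH]; last exact: coarsely_bijective_Shuffler.
    apply: (@lattice_charts_bijective _ _ a).
      exact: lattice_chart_growth Aa.
    exact: lattice_chart_growth Bb.
- by move=> [S [T [gS gT [f _ fq]]]]; exists S, T; split=> //; exists f.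
Qed.
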